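(* Let $(V,\Upsilon(z),c,\rho)$ be a graded vertex operator coalgebra with $\rho\in V_2^*$ and $(\mathcal M,\Upsilon_{\mathcal M}(z))$ an admissible $V$-comodule all of whose homogeneous subspaces are finite dimensional. Then the double contragredient comodule $\mathcal M''=(\mathcal M')'$ is isomorphic to $\mathcal M$ as an admissible $V$-comodule.
   Context: Everything is over $\mathbb C$; $\tau(v\otimes w)=w\otimes v$; $\delta(x)=\sum_{n\in\mathbb Z}x^n$; $(z_1+z_2)^n$ is expanded in nonnegative powers of the second variable; $(\cdot,\cdot)$ is the natural pairing of a space with its dual (in either order). A graded vertex operator coalgebra is a tuple $(V,\Upsilon(z),c,\rho)$: a $\mathbb Z$-graded space $V=\bigoplus_s V_s$ with $\dim V_s<\infty$, $V_s=0$ for $s\ll0$; linear maps $c,\rho:V\to\mathbb C$; a linear map $\Upsilon(z):V\to (V\otimes V)[[z,z^{-1}]]$, $v\mapsto\sum_{k\in\mathbb Z}\Delta_k(v)z^{-k-1}$, such that: (i) each $\Delta_k(v)\in V\otimes V$ and $\Delta_k(v)=0$ for $k\ll0$; $\Delta_k(V_s)\subset (V\otimes V)_{s+k+1}$; (ii) $(c\otimes\mathrm{Id})\Upsilon(z)v=v$, $(\mathrm{Id}\otimes c)\Upsilon(z)v\in V[[z]]$, with limit $v$ as $z\to0$; (iii) Jacobi identity $$z_0^{-1}\delta\big(\tfrac{z_1-z_2}{z_0}\big)(\mathrm{Id}\otimes\Upsilon(z_2))\Upsilon(z_1)-z_0^{-1}\delta\big(\tfrac{z_2-z_1}{-z_0}\big)(\tau\otimes\mathrm{Id})(\mathrm{Id}\otimes\Upsilon(z_1))\Upsilon(z_2)=z_1^{-1}\delta\big(\tfrac{z_2+z_0}{z_1}\big)(\Upsilon(z_0)\otimes\mathrm{Id})\Upsilon(z_2);$$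 (iv) writing $(\rho\otimes\mathrm{Id})\Upsilon(z)=\sum_kL_V(k)z^{k-2}$ with $L_V(k)\in\mathrm{End}(V)$, one has $[L_V(k),L_V(j)]=(k-j)L_V(k+j)+\frac{k^3-k}{12}\delta_{k+j,0}d$ for a constant $d\in\mathbb C$ (the rank); $V_s$ is the eigenspace of $L_V(0)$ with eigenvalue $s$; and $(L_V(1)\otimes\mathrm{Id})\Upsilon(z)=\frac{d}{dz}\Upsilon(z)=\Upsilon(z)L_V(1)-(\mathrm{Id}\otimes L_V(1))\Upsilon(z)$. Put $V'=\bigoplus_sV_s^*$. An admissible $V$-comodule $(\mathcal M,\Upsilon_{\mathcal M}(z))$ is an $\mathbb N$-graded space $\mathcal M=\bigoplus_{t\in\mathbb N}M(t)$ with a linear map $\Upsilon_{\mathcal M}(z):\mathcal M\to (V\otimes\mathcal M)[[z,z^{-1}]]$, $\Upsilon_{\mathcal M}(z)=\sum_k\Delta_{\mathcal M,k}z^{-k-1}$, such that: each $\Delta_{\mathcal M,k}(m)\in V\otimes \mathcal M$ is a finite sum and vanishes for $k\ll0$; $(c\otimes\mathrm{Id})\Upsilon_{\mathcal M}(z)m=m$; the Jacobi identity $$z_0^{-1}\delta\big(\tfrac{z_1-z_2}{z_0}\big)(\mathrm{Id}\otimes\Upsilon_{\mathcal M}(z_2))\Upsilon_{\mathcal M}(z_1)-z_0^{-1}\delta\big(\tfrac{z_2-z_1}{-z_0}\big)(\tau\otimes\mathrm{Id})(\mathrm{Id}\otimes\Upsilon_{\mathcal M}(z_1))\Upsilon_{\mathcal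 M}(z_2)=z_1^{-1}\delta\big(\tfrac{z_2+z_0}{z_1}\big)(\Upsilon(z_0)\otimes\mathrm{Id})\Upsilon_{\mathcal M}(z_2);$$ writing $(\rho\otimes\mathrm{Id})\Upsilon_{\mathcal M}(z)=\sum_kL_V(k)z^{k-2}$ with $L_V(k)\in\mathrm{End}(\mathcal M)$, the same Virasoro relations hold on $\mathcal M$; $(L_V(1)\otimes\mathrm{Id})\Upsilon_{\mathcal M}(z)=\frac{d}{dz}\Upsilon_{\mathcal M}(z)=\Upsilon_{\mathcal M}(z)L_V(1)-(\mathrm{Id}\otimes L_V(1))\Upsilon_{\mathcal M}(z)$; and $\Delta_{\mathcal M,k}(M(t))\subset\bigoplus_{s\in\mathbb N}V_{t+k+1-s}\otimes M(s)$. A comodule homomorphism $\psi:\mathcal M_1\to\mathcal M_2$ is a linear map with $(\mathrm{Id}\otimes\psi)\Upsilon_{\mathcal M_1}(z)=\Upsilon_{\mathcal M_2}(z)\psi$. Contragredient comodule: for $\mathcal M$ with finite-dimensional $M(s)$, $\mathcal M'=\bigoplus_sM(s)^*$ with the admissible $V$-comodule structure $\Upsilon'_{\mathcal M'}(z)$ given by $$\big(\Upsilon'_{\mathcal M'}(z)m^*,f\otimes m\big)=\Big(f\otimes m^*,\big((-z^{-2})^{L_V(0)}e^{zL_V(-1)}\otimes \mathrm{Id}\big)\circ\Upsilon_{\mathcal M}(z^{-1})m\Big),\quad f\in V',\ m\in\mathcal M,\ m^*\in\mathcal M',$$ where $(-z^{-2})^{L_V(0)}v=(-z^{-2})^sv$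 for $v\in V_s$. *)

(* Defs.v *)
From HB Require Import structures.
From mathcomp Require Import all_boot all_order all_algebra.
From mathcomp Require Import generic_quotient ring_quotient sesquilinear.
From mathcomp Require Import all_classical finmap zify.
From mathcomp.multinomials Require Import freeg.

Set Implicit Arguments.
Unset Strict Implicit.
Unset Printing Implicit Defensive.

Import GRing.Theory.

Local Open Scope ring_scope.
Local Open Scope classical_set_scope.
Local Open Scope quotient_scope.

Section Hom.
Variables (K : fieldType) (U W : lmodType K).
Implicit Types f g h : {linear U -> W}.

Lemma linear_ext f g : f =1 g -> f = g.
Proof.
case: f => [f [[Df] [Sf]]]; case: g => [g [[Dg] [Sg]]] /= /funext e.
rewrite -{}e in Dg Sg *.
by rewrite (Prop_irrelevance Df Dg) (Prop_irrelevance Sf Sg).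
Qed.

HB.instance Definition _ := gen_eqMixin {linear U -> W}.
HB.instance Definition _ := gen_choiceMixin {linear U -> W}.

Definition hom_zero : {linear U -> W} := \0.
Definition hom_add f g : {linear U -> W} := f \+ g.
Definition hom_opp f : {linear U -> W} := \- f.
Definition hom_scale (a : K) f : {linear U -> W} := a \*: f.

Lemma hom_addA : associative hom_add.
Proof. by move=> f g h; apply: linear_ext => u /=; rewrite addrA. Qed.
Lemma hom_addC : commutative hom_add.
Proof. by move=> f g; apply: linear_ext => u /=; rewrite addrC. Qed.
Lemma hom_add0 : left_id hom_zero hom_add.
Proof. by move=> f; apply: linear_ext => u /=; rewrite add0r. Qed.
Lemma hom_addN : left_inverse hom_zero hom_opp hom_add.
Proof. by move=> f; apply: linear_ext => u /=; rewrite addNr. Qed.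

HB.instance Definition _ := GRing.isZmodule.Build {linear U -> W}
  hom_addA hom_addC hom_add0 hom_addN.

Lemma hom_scaleA a b f : hom_scale a (hom_scale b f) = hom_scale (a * b) f.
Proof. by apply: linear_ext => u /=; rewrite scalerA. Qed.
Lemma hom_scale1 : left_id 1 hom_scale.
Proof. by move=> f; apply: linear_ext => u /=; rewrite scale1r. Qed.
Lemma hom_scaleDr : right_distributive hom_scale +%R.
Proof. by move=> a f g; apply: linear_ext => u /=; rewrite scalerDr. Qed.
Lemma hom_scaleDl f : {morph hom_scale^~ f : a b / a + b}.
Proof. by move=> a b; apply: linear_ext => u /=; rewrite scalerDl. Qed.

HB.instance Definition _ := GRing.Zmodule_isLmodule.Build K {linear U -> W}
  hom_scaleA hom_scale1 hom_scaleDr hom_scaleDl.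

End Hom.

Section DirectProduct.
Variables (K : fieldType) (I : Type) (F : I -> lmodType K).

Definition dprod := forall i, F i.

HB.instance Definition _ := Choice.on dprod.

Implicit Types x y z : dprod.

Definition dprod_zero : dprod := fun=> 0.
Definition dprod_add x y : dprod := fun i => x i + y i.
Definition dprod_opp x : dprod := fun i => - x i.
Definition dprod_scale (a : K) x : dprod := fun i => a *: x i.

Lemma dprod_addA : associative dprod_add.
Proof. by move=> x y z; apply/functional_extensionality_dep => i; exact: addrA. Qed.
Lemma dprod_addC : commutative dprod_add.
Proof. by move=> x y; apply/functional_extensionality_dep => i; exact: addrC. Qed.
Lemma dprod_add0 : left_id dprod_zero dprod_add.
Proof. by move=> x; apply/functional_extensionality_dep => i; exact: add0r. Qed.
Lemma dprod_addN : left_inverse dprod_zero dprod_opp dprod_add.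
Proof. by move=> x; apply/functional_extensionality_dep => i; exact: addNr. Qed.

HB.instance Definition _ := GRing.isZmodule.Build dprod
  dprod_addA dprod_addC dprod_add0 dprod_addN.

Lemma dprod_scaleA a b x : dprod_scale a (dprod_scale b x) = dprod_scale (a * b) x.
Proof. by apply/functional_extensionality_dep => i; exact: scalerA. Qed.
Lemma dprod_scale1 : left_id 1 dprod_scale.
Proof. by move=> x; apply/functional_extensionality_dep => i; exact: scale1r. Qed.
Lemma dprod_scaleDr : right_distributive dprod_scale +%R.
Proof. by move=> a x y; apply/functional_extensionality_dep => i; exact: scalerDr. Qed.
Lemma dprod_scaleDl x : {morph dprod_scale^~ x : a b / a + b}.
Proof. by move=> a b; apply/functional_extensionality_dep => i; exact: scalerDl. Qed.

HB.instance Definition _ := GRing.Zmodule_isLmodule.Build K dprod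
  dprod_scaleA dprod_scale1 dprod_scaleDr dprod_scaleDl.

Lemma dprodD x y i : (x + y) i = x i + y i. Proof. by []. Qed.
Lemma dprodN x i : (- x) i = - x i. Proof. by []. Qed.
Lemma dprodZ a x i : (a *: x) i = a *: x i. Proof. by []. Qed.

End DirectProduct.

Section DirectSum.
Variables (K : fieldType) (I : choiceType) (F : I -> lmodType K).

Definition finsupp : {pred dprod F} :=
  fun x => `[< finite_set [set i | x i != 0] >].

Lemma finsupp_submod_closed : submod_closed finsupp.
Proof.
split=> [|a x y /asboolP fx /asboolP fy]; apply/asboolP.
  by apply: sub_finite_set (finite_set0 I) => i /=; rewrite eqxx.
apply: (@sub_finite_set _ _ ([set i | x i != 0] `|` [set i | y i != 0])).
  move=> i /=; apply: contraPP => /not_orP[/negP + /negP].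
  rewrite !negbK dprodD dprodZ => /eqP -> /eqP ->.
  by rewrite scaler0 addr0 eqxx.
by rewrite finite_setU.
Qed.

HB.instance Definition _ :=
  GRing.isSubmodClosed.Build K (dprod F) finsupp finsupp_submod_closed.

Record dsum := DSum { dsum_val :> dprod F ; _ : dsum_val \in finsupp }.

HB.instance Definition _ := [isSub for dsum_val].
HB.instance Definition _ := [Choice of dsum by <:].
HB.instance Definition _ := [SubChoice_isSubLmodule of dsum by <:].

Lemma inj_finsupp i (x : F i) : eqtype.dfwith (fun j => 0 : F j) x \in finsupp.
Proof.
apply/asboolP; apply: sub_finite_set (finite_set1 i) => j /=.
move/eqP => nz; apply/eqP/negPn/negP => ji; apply: nz.
by rewrite dfwith_out // eq_sym.
Qed.

Definition inj i (x : F i) : dsum := DSum (inj_finsupp x).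

End DirectSum.

Section QuotientSpace.
Variables (K : fieldType) (F : lmodType K) (S : {pred F}).
Hypothesis submodS : submod_closed S.

Let zmodS : zmodClosed F :=
  HB.pack S (GRing.isZmodClosed.Build F S (GRing.submod_closedB submodS)).

Definition quotsp := Quotient.quot zmodS.

HB.instance Definition _ := GRing.Zmodule.on quotsp.

Definition quotsp_pi (x : F) : quotsp := \pi_quotsp x.

Lemma quotsp_eq x y : quotsp_pi x = quotsp_pi y <-> x - y \in S.
Proof.
by rewrite -[_ \in S]/(_ \in zmodS) (Quotient.idealrBE zmodS x y); split=> [/eqP|/eqP].
Qed.

Lemma quotsp_pi_surj t : exists x, t = quotsp_pi x.
Proof. by exists (repr t); rewrite /quotsp_pi reprK. Qed.

Lemma quotsp_piD x y : quotsp_pi (x + y) = quotsp_pi x + quotsp_pi y.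
Proof. exact: raddfD. Qed.

Definition quotsp_scale (a : K) (t : quotsp) : quotsp := quotsp_pi (a *: repr t).

Lemma quotsp_scaleE a x : quotsp_scale a (quotsp_pi x) = quotsp_pi (a *: x).
Proof.
apply/quotsp_eq; rewrite -scalerBr -[_ *: _]addr0; apply: submodS.2 submodS.1.
by apply/quotsp_eq; rewrite {1}/quotsp_pi reprK.
Qed.

Lemma quotsp_scaleA a b t :
  quotsp_scale a (quotsp_scale b t) = quotsp_scale (a * b) t.
Proof.
by have [x ->] := quotsp_pi_surj t; rewrite (quotsp_scaleE b) !quotsp_scaleE scalerA.
Qed.
Lemma quotsp_scale1 : left_id 1 quotsp_scale.
Proof. by move=> t; have [x ->] := quotsp_pi_surj t; rewrite quotsp_scaleE scale1r. Qed.
Lemma quotsp_scaleDr : right_distributive quotsp_scale +%R.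
Proof.
move=> a s t; have [x ->] := quotsp_pi_surj s; have [y ->] := quotsp_pi_surj t.
by rewrite -quotsp_piD !quotsp_scaleE scalerDr quotsp_piD.
Qed.
Lemma quotsp_scaleDl t : {morph quotsp_scale^~ t : a b / a + b}.
Proof.
move=> a b; have [x ->] := quotsp_pi_surj t.
by rewrite !quotsp_scaleE scalerDl quotsp_piD.
Qed.

HB.instance Definition _ := GRing.Zmodule_isLmodule.Build K quotsp
  quotsp_scaleA quotsp_scale1 quotsp_scaleDr quotsp_scaleDl.

Lemma quotsp_pi_linear : linear quotsp_pi.
Proof. by move=> a x y; rewrite quotsp_piD -quotsp_scaleE. Qed.

HB.instance Definition _ :=
  GRing.isLinear.Build K F quotsp *:%R quotsp_pi quotsp_pi_linear.

End QuotientSpace.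

Section FreeLift.
Variables (K : fieldType) (T : choiceType) (X : lmodType K) (f : T -> X).

Lemma fglift_linear : linear (fglift f : {freeg T / K} -> X).
Proof.
have lB := lift_is_additive f.
have l0 : fglift f 0 = 0 by rewrite -(subr0 0) lB subrr.
have lD x y : fglift f (x + y) = fglift f x + fglift f y.
  by rewrite -[y in LHS]opprK -[- y]sub0r !lB l0 sub0r opprK.
move=> a x y; rewrite lD; congr (_ + _).
have lS r (G : T -> {freeg T / K}) :
    fglift f (\sum_(t <- r) G t) = \sum_(t <- r) fglift f (G t).
  by elim/big_rec2: _ => // t _ z _ <-; rewrite lD.
rewrite -{2}[x]freeg_sumE {1}/GRing.scale /= /fgscale !lS scaler_sumr.
by apply: eq_bigr => t _; rewrite !liftU scalerA.
Qed.

HB.instance Definition _ := GRing.isLinear.Build K {freeg T / K} X *:%R (fglift f)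
  fglift_linear.

End FreeLift.

(* A tensor product of U and W, specified by its universal property *)
Record tensor_product (K : fieldType) (U W : lmodType K) := TensorProduct {
  tp_space : lmodType K ;
  tp_tens : U -> W -> tp_space ;
  tp_bilinear : bilinear_for *:%R *:%R tp_tens ;
  tp_universal : forall (X : lmodType K) (b : {bilinear U -> W -> X}),
    exists! f : {linear tp_space -> X}, forall u w, f (tp_tens u w) = b u w
}.

Section TensorConstruction.
Variables (K : fieldType) (U W : lmodType K).

Local Notation free := ({freeg (U * W)%type / K}).

Inductive tensor_relator : free -> Prop :=
| RelL a u u' w : tensor_relator
    (<< (a *: u + u', w) >> - a *: << (u, w) >> - << (u', w) >>)
| RelR a u w w' : tensor_relator
    (<< (u, a *: w + w') >> - a *: << (u, w) >> - << (u, w') >>).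

Inductive tensor_relation : free -> Prop :=
| Rel0 : tensor_relation 0
| RelS a x y : tensor_relator x -> tensor_relation y ->
    tensor_relation (a *: x + y).

Definition tensor_rel : {pred free} := fun x => `[< tensor_relation x >].

Lemma tensor_rel_submod_closed : submod_closed tensor_rel.
Proof.
split; first by apply/asboolP; constructor.
move=> a x y /asboolP rx /asboolP ry; apply/asboolP.
elim: rx => [|b r x' rr _ IH]; first by rewrite scaler0 add0r.
by rewrite scalerDr scalerA -addrA; apply: RelS rr IH.
Qed.

Local Notation quot := (quotsp tensor_rel_submod_closed).
Local Notation tensor_pi := (quotsp_pi tensor_rel_submod_closed).

Let pure (u : U) (w : W) : quot := tensor_pi << (u, w) >>.

Let pure_bilinear : bilinear_for *:%R *:%R pure.
Proof.
have relP a x y z : tensor_relator (x - a *: y - z) ->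
    tensor_pi x = a *: tensor_pi y + tensor_pi z.
  move=> r; rewrite -linearP; apply/quotsp_eq; rewrite opprD addrA.
  by apply/asboolP; rewrite -[X in tensor_relation X]addr0 -[X in X + _]scale1r;
     apply: RelS r Rel0.
by split=> [w a u u'|u a w w'];
  [have := relP _ _ _ _ (RelL a u u' w) | have := relP _ _ _ _ (RelR a u w w')].
Qed.

Let pure_span (x : free) :
  tensor_pi x = \sum_(p <- dom x) coeff p x *: pure p.1 p.2.
Proof.
rewrite -{1}[x]freeg_sumE linear_sum /=; apply: eq_bigr => -[u w] _ /=.
set c := coeff _ _.
have -> : << c *g (u, w) >> = c *: << (u, w) >> :> free.
  by apply/eqP/freeg_eqP => k; rewrite coeffZ !coeffU mul1r.
by rewrite linearZ.
Qed.

Section Lift.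
Variables (X : lmodType K) (b : {bilinear U -> W -> X}).

Let f (p : U * W) := b p.1 p.2.

Let lift (t : quot) : X := fglift f (repr t).

Let lift_pi x : lift (tensor_pi x) = fglift f x.
Proof.
apply/eqP; rewrite -subr_eq0 -raddfB; apply/eqP.
have /asboolP : repr (tensor_pi x) - x \in tensor_rel.
  by apply/(quotsp_eq tensor_rel_submod_closed); rewrite {1}/quotsp_pi reprK.
have fE c p q r : fglift f (<< p >> - c *: << q >> - << r >>) = f p - c *: f q - f r.
  by rewrite !raddfB /= [fglift f (_ *: _)]linearZ /= !liftU !scale1r.
elim=> [|a r y rr _ IH]; first exact: raddf0.
rewrite /= in IH *; rewrite fglift_linear IH addr0; apply/eqP.
rewrite scaler_eq0; apply/orP; right; apply/eqP.
by case: rr => [c u u' w|c u w w']; rewrite fE /f ?linearPl ?linearPr /=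
  [in LHS]addrAC addrK subrr.
Qed.

Let lift_linear : linear lift.
Proof.
move=> a s t; have [x ->] := quotsp_pi_surj s; have [y ->] := quotsp_pi_surj t.
by rewrite -linearP !lift_pi linearP.
Qed.

Lemma pure_universal :
  exists! g : {linear quot -> X}, forall u w, g (pure u w) = b u w.
Proof.
pose g : {linear quot -> X} :=
  HB.pack lift (GRing.isLinear.Build K quot X *:%R lift lift_linear).
exists g; split=> [u w|h hE]; first by rewrite [LHS]lift_pi liftU scale1r.
apply: linear_ext => t; have [x ->] := quotsp_pi_surj t.
rewrite pure_span !linear_sum; apply: eq_bigr => p _.
by rewrite !linearZ hE [in LHS]/= lift_pi liftU scale1r.
Qed.

End Lift.

(* Kept opaque: all that is used of the tensor product is its universal property. *)
Lemma tensor_product_exists : tensor_product U W.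
Proof. exact: TensorProduct pure_bilinear pure_universal. Qed.

End TensorConstruction.

Section Tensor.
Variables (K : fieldType) (U W : lmodType K).

(* U (x) W; [tens u w] is u (x) w *)
Definition tensor : lmodType K := tp_space (tensor_product_exists U W).

Definition tens (u : U) (w : W) : tensor := tp_tens (tensor_product_exists U W) u w.

Lemma tens_bilinear : bilinear_for *:%R *:%R tens.
Proof. exact: tp_bilinear. Qed.

HB.instance Definition _ := bilinear_isBilinear.Build K U W tensor *:%R *:%R tens
  tens_bilinear.

HB.instance Definition _ (u : U) := GRing.isLinear.Build K W tensor *:%R (tens u)
  (tens_bilinear.2 u).

Lemma tensPl a u u' w : tens (a *: u + u') w = a *: tens u w + tens u' w.
Proof. exact: tens_bilinear.1. Qed.
Lemma tensPr u a w w' : tens u (a *: w + w') = a *: tens u w + tens u w'.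
Proof. exact: tens_bilinear.2. Qed.

Definition tlift (X : lmodType K) (b : {bilinear U -> W -> X}) : {linear tensor -> X} :=
  projT1 (cid (tp_universal (tensor_product_exists U W) b)).

Lemma tliftE (X : lmodType K) (b : {bilinear U -> W -> X}) u w :
  tlift b (tens u w) = b u w.
Proof. by rewrite /tlift; case: cid => f [/= ->]. Qed.

Lemma tensor_ext (X : lmodType K) (f g : {linear tensor -> X}) :
  (forall u w, f (tens u w) = g (tens u w)) -> f = g.
Proof.
move=> fg.
have fB : bilinear_for *:%R *:%R (fun u w => f (tens u w)).
  split=> [w a u u'|u a w w'].
    by rewrite tensPl linearP.
  by rewrite tensPr linearP.
pose b : {bilinear U -> W -> X} := HB.pack (fun u w => f (tens u w))
  (bilinear_isBilinear.Build K U W X *:%R *:%R _ fB).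
have [h [_ hU]] := tp_universal (tensor_product_exists U W) b.
by rewrite -(hU f) // -(hU g) // => u w; rewrite -[RHS]/(f (tens u w)) fg.
Qed.

Lemma tensor_ind (P : tensor -> Prop) :
  P 0 -> (forall u w t, P t -> P (tens u w + t)) -> forall t, P t.
Proof.
move=> P0 PD.
pose sum (s : seq (U * W)) : tensor := \sum_(p <- s) tens p.1 p.2.
pose S : {pred tensor} := fun t => `[< exists s, t = sum s >].
have clS : submod_closed S.
  split; first by apply/asboolP; exists [::]; rewrite /sum big_nil.
  move=> a _ _ /asboolP[s ->] /asboolP[s' ->]; apply/asboolP.
  exists ([seq (a *: p.1, p.2) | p <- s] ++ s').
  rewrite /sum big_cat big_map scaler_sumr; congr (_ + _).
  by apply: eq_bigr => p _ /=; rewrite linearZl_LR.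
have pi0 : (quotsp_pi clS : {linear _ -> _}) = \0.
  apply: tensor_ext => u w /=; rewrite -(raddf0 (quotsp_pi clS)).
  apply/quotsp_eq; rewrite subr0; apply/asboolP.
  by exists [:: (u, w)]; rewrite /sum big_seq1.
move=> t; have /asboolP[s ->] : t \in S.
  have : quotsp_pi clS t = quotsp_pi clS 0.
    by rewrite -[LHS]/((quotsp_pi clS : {linear _ -> _}) t) pi0 raddf0.
  by move/quotsp_eq; rewrite subr0.
by rewrite /sum; elim/big_rec: _ => // p x _; apply: PD.
Qed.

End Tensor.

Section TensorMaps.
Variable K : fieldType.
Implicit Types U W X : lmodType K.

(* [tmap f g] is f (x) g. *)
Definition tmap_bil U U' W W' (f : {linear U -> U'}) (g : {linear W -> W'}) u w :
  tensor U' W' := tens (f u) (g w).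

Lemma tmap_bilinear U U' W W' (f : {linear U -> U'}) (g : {linear W -> W'}) :
  bilinear_for *:%R *:%R (tmap_bil f g).
Proof.
split=> [w a u u'|u a w w']; rewrite /tmap_bil linearP.
  exact: (tens_bilinear _ _).1.
exact: (tens_bilinear _ _).2.
Qed.

HB.instance Definition _ U U' W W' (f : {linear U -> U'}) (g : {linear W -> W'}) :=
  bilinear_isBilinear.Build K U W (tensor U' W') *:%R *:%R (tmap_bil f g)
    (tmap_bilinear f g).

Definition tmap U U' W W' (f : {linear U -> U'}) (g : {linear W -> W'}) :
  {linear tensor U W -> tensor U' W'} := tlift (tmap_bil f g).

Lemma tmapE U U' W W' (f : {linear U -> U'}) (g : {linear W -> W'}) u w :
  tmap f g (tens u w) = tens (f u) (g w).
Proof. exact: tliftE. Qed.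

(* u (x) w |-> w (x) u *)
Definition tswap_bil U W (u : U) (w : W) : tensor W U := tens w u.

Lemma tswap_bilinear U W : bilinear_for *:%R *:%R (@tswap_bil U W).
Proof. by have [l r] := tens_bilinear W U; split. Qed.

HB.instance Definition _ U W :=
  bilinear_isBilinear.Build K U W (tensor W U) *:%R *:%R (@tswap_bil U W)
    (@tswap_bilinear U W).

Definition tswap U W : {linear tensor U W -> tensor W U} := tlift (@tswap_bil U W).

Lemma tswapE U W (u : U) (w : W) : tswap U W (tens u w) = tens w u.
Proof. exact: tliftE. Qed.

(* u (x) (w (x) x) |-> (u (x) w) (x) x *)
Definition tassoc_bil U W X (u : U) (t : tensor W X) : tensor (tensor U W) X :=
  tmap (@tens K U W u) idfun t.

Lemma tassoc_bilinear U W X : bilinear_for *:%R *:%R (@tassoc_bil U W X).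
Proof.
split=> [t a u u'|u]; last exact: linearP.
rewrite /tassoc_bil /=; elim/tensor_ind: t => [|w x t IH].
  by rewrite !linear0 addr0.
rewrite !linearD IH !tmapE /= !tensPl.
by rewrite !addrA; congr (_ + _); rewrite addrAC.
Qed.

HB.instance Definition _ U W X :=
  bilinear_isBilinear.Build K U (tensor W X) (tensor (tensor U W) X) *:%R *:%R
    (@tassoc_bil U W X) (@tassoc_bilinear U W X).

Definition tassoc U W X : {linear tensor U (tensor W X) -> tensor (tensor U W) X} :=
  tlift (@tassoc_bil U W X).

Lemma tassocE U W X (u : U) (w : W) (x : X) :
  tassoc U W X (tens u (tens w x)) = tens (tens u w) x.
Proof. by rewrite tliftE [LHS]tmapE. Qed.

(* [tcontl W f], [tcontr U f] and [tform f g] are f (x) Id, Id (x) f and f (x) g for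
   linear forms f and g, followed by the identifications K (x) W = W, U (x) K = U
   and K (x) K = K. *)
Definition tcontl_bil U W (f : {linear U -> K^o}) (u : U) (w : W) : W := f u *: w.

Lemma tcontl_bilinear U W (f : {linear U -> K^o}) :
  bilinear_for *:%R *:%R (@tcontl_bil U W f).
Proof.
split=> [w a u u'|u a w w']; rewrite /tcontl_bil /=.
  by rewrite linearP scalerDl scalerA.
by rewrite scalerDr !scalerA mulrC.
Qed.

HB.instance Definition _ U W (f : {linear U -> K^o}) :=
  bilinear_isBilinear.Build K U W W *:%R *:%R (@tcontl_bil U W f)
    (@tcontl_bilinear U W f).

Definition tcontl U W (f : {linear U -> K^o}) : {linear tensor U W -> W} :=
  tlift (@tcontl_bil U W f).

Lemma tcontlE U W (f : {linear U -> K^o}) (u : U) (w : W) :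
  tcontl W f (tens u w) = f u *: w.
Proof. exact: tliftE. Qed.

Definition tcontr U W (f : {linear W -> K^o}) : {linear tensor U W -> U} :=
  tlift (@tcontl_bil W U f) \o tswap U W.

Lemma tcontrE U W (f : {linear W -> K^o}) (u : U) (w : W) :
  tcontr U f (tens u w) = f w *: u.
Proof. by rewrite /= tswapE tliftE. Qed.

Definition tform U W (f : {linear U -> K^o}) (g : {linear W -> K^o}) :
  {linear tensor U W -> K^o} := g \o tcontl W f.

Lemma tformE U W (f : {linear U -> K^o}) (g : {linear W -> K^o}) u w :
  tform f g (tens u w) = f u * g w.
Proof. by rewrite /= tcontlE linearZ. Qed.

End TensorMaps.

Section Graded.
Variables (K : fieldType).

(* [homogeneous P t]: t lies in the sum of the subspaces A_i (x) B_j of A (x) B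
   such that P i j. *)
Inductive homogeneous (I J : choiceType) (A : I -> lmodType K) (B : J -> lmodType K)
  (P : I -> J -> Prop) : tensor (dsum A) (dsum B) -> Prop :=
| Homogeneous0 : homogeneous P 0
| HomogeneousD i j (x : A i) (y : B j) t : P i j -> homogeneous P t ->
    homogeneous P (tens (inj x) (inj y) + t).

Definition finite_dim (U : lmodType K) : Prop :=
  exists n (e : 'I_n -> U), forall u, exists a : 'I_n -> K, u = \sum_i a i *: e i.

Variables (I : choiceType) (F : I -> lmodType K).

Definition dual_family (i : I) : lmodType K := {linear F i -> K^o}.

(* the restricted dual of the direct sum of the F_i *)
Local Notation gdual := (dsum dual_family).

(* The pairing of the restricted dual with the direct product of the F_i,
   and by restriction with their direct sum *)
Definition gpair (f : gdual) (x : dprod F) : K^o := \sum_(i \in [set: I]) (dsum_val f i : {linear F i -> K^o}) (x i).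

Lemma gdual_finite (f : gdual) : finite_set [set i | dsum_val f i != 0].
Proof. by have /asboolP := valP f. Qed.

Lemma gpairE (A : {fset I}) (f : gdual) x : (forall i, i \notin A -> dsum_val f i = 0) ->
  gpair f x = \sum_(i <- A) (dsum_val f i : {linear F i -> K^o}) (x i).
Proof. by move=> fA; apply: fsbigTE => i /fA ->. Qed.

Lemma gpair_linear (f : gdual) : linear (gpair f).
Proof.
move=> a x y; have fA i : i \notin fset_set [set i | dsum_val f i != 0] -> dsum_val f i = 0.
  rewrite in_fset_set; last exact: gdual_finite.
  by rewrite notin_setE /= => /negP; rewrite negbK => /eqP.
rewrite !(gpairE _ fA) scaler_sumr -big_split.
by apply: eq_bigr => i _; rewrite dprodD dprodZ linearP.
Qed.

HB.instance Definition _ (f : gdual) :=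
  GRing.isLinear.Build K (dprod F) K^o *:%R (gpair f) (gpair_linear f).

(* f in the restricted dual, as a linear form *)
Definition gform (f : gdual) (x : dsum F) : K^o := gpair f x.

Lemma gform_linear (f : gdual) : linear (gform f).
Proof. by move=> a x y; rewrite /gform -gpair_linear. Qed.

HB.instance Definition _ (f : gdual) :=
  GRing.isLinear.Build K (dsum F) K^o *:%R (gform f) (gform_linear f).

(* x in the direct sum, as a linear form on the restricted dual *)
Definition geval (x : dsum F) (f : gdual) : K^o := gpair f x.

Lemma geval_linear (x : dsum F) : linear (geval x).
Proof.
move=> a f g; rewrite /geval.
pose A := fset_set ([set i | dsum_val f i != 0] `|` [set i | dsum_val g i != 0]).
have AP i : i \notin A -> dsum_val f i = 0 /\ dsum_val g i = 0.
  rewrite in_fset_set; last by rewrite finite_setU; split; apply: gdual_finite.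
  rewrite notin_setE /= => /not_orP[/negP + /negP +].
  by rewrite !negbK => /eqP -> /eqP ->.
rewrite (@gpairE A (a *: f + g)); last first.
  by move=> i /AP[fi gi]; rewrite -[LHS]/(a *: dsum_val f i + dsum_val g i) fi gi addr0 scaler0.
rewrite !(@gpairE A) => [|i /AP[]//|i /AP[]//].
by rewrite scaler_sumr -big_split.
Qed.

HB.instance Definition _ (x : dsum F) :=
  GRing.isLinear.Build K gdual K^o *:%R (geval x) (geval_linear x).

End Graded.

(* A formal series in U[[z, z^-1]] is the function int -> U giving its coefficient
   at each power of z, and similarly with several variables. *)

Section FormalSeries.
Variable K : fieldType.

Definition zderiv (U : lmodType K) (F : int -> U) : int -> U :=
  fun e => (e + 1)%:~R *: F (e + 1).

Definition binz (n : int) (i : nat) : K :=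
  (\prod_(j < i) (n%:~R - j%:R)) / i`!%:R.

(* the coefficient of x^p y^q in (x + s y)^n, expanded in nonnegative powers of y *)
Definition binom_coef (n : int) (s : K) (p q : int) : K :=
  if q is Posz i then (if p == n - i%:Z then binz n i * s ^+ i else 0) else 0.

(* In the three series below, a, b, c are the exponents of z0, z1, z2. *)

(* z0^-1 delta((z1 - z2)/z0), the sum over n of z0^(-n-1) (z1 - z2)^n *)
Definition delta12 (a b c : int) : K := binom_coef (- a - 1) (-1) b c.

(* z0^-1 delta((z2 - z1)/(- z0)), the sum over n of
   (-1)^n z0^(-n-1) (z2 - z1)^n *)
Definition delta21 (a b c : int) : K :=
  (-1) ^ (- a - 1) * binom_coef (- a - 1) (-1) c b.

(* z1^-1 delta((z2 + z0)/z1), the sum over n of z1^(-n-1) (z2 + z0)^n *)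
Definition delta20 (a b c : int) : K := binom_coef (- b - 1) 1 c a.

Variable U : lmodType K.

(* The products k(z0,z1,z2) F(z1,z2) and k(z0,z1,z2) F(z0,z2); each coefficient is
   a finitely supported sum. *)
Definition zmul12 (k : int -> int -> int -> K) (F : int -> int -> U) (a b c : int) : U :=
  \sum_(p \in [set: int * int]) k a (b - p.1) (c - p.2) *: F p.1 p.2.

Definition zmul02 (k : int -> int -> int -> K) (F : int -> int -> U) (a b c : int) : U :=
  \sum_(p \in [set: int * int]) k (a - p.1) b (c - p.2) *: F p.1 p.2.

End FormalSeries.

Section Coaction.
Variables (K : fieldType) (V U : lmodType K).
Implicit Types (D : int -> {linear U -> tensor V U}) (c rho : {linear V -> K^o}).

(* D = (D_k) encodes Y(z) = sum_k D_k z^(-k-1); [Ycoef D u e] is the coefficient of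
   z^e in Y(z)u. *)
Definition Ycoef D (u : U) (e : int) : tensor V U := D (- e - 1) u.

(* the operators L(k) such that (rho (x) Id)Y(z) = sum_k L(k) z^(k-2) *)
Definition Lop rho D (k : int) : {linear U -> U} := tcontl U rho \o D (1 - k).

Lemma LopE rho D k u : Lop rho D k u = tcontl U rho (Ycoef D u (k - 2)).
Proof. by rewrite /Ycoef /=; congr (tcontl U rho (D _ u)); lia. Qed.

End Coaction.

Section CoactionAxioms.
Variables (K : fieldType) (V U : lmodType K).
Implicit Types (D : int -> {linear U -> tensor V U}) (c rho : {linear V -> K^o}).

Definition truncated D : Prop :=
  forall u, exists N : int, forall k : int, k < N -> D k u = 0.

Definition left_counit c D : Prop :=
  forall u e, tcontl U c (Ycoef D u e) = if e == 0 then u else 0.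

Definition jacobi (DV : int -> {linear V -> tensor V V}) D : Prop :=
  forall u a b d,
    zmul12 (@delta12 K) (fun e1 e2 =>
      tassoc V V U (tmap idfun (D (- e2 - 1)) (Ycoef D u e1))) a b d
    - zmul12 (@delta21 K) (fun e1 e2 =>
      tmap (tswap V V) idfun
        (tassoc V V U (tmap idfun (D (- e1 - 1)) (Ycoef D u e2)))) a b d
    = zmul02 (@delta20 K) (fun e0 e2 =>
      tmap (DV (- e0 - 1)) idfun (Ycoef D u e2)) a b d.

Definition virasoro rho D (r : K) : Prop :=
  forall k j u,
    Lop rho D k (Lop rho D j u) - Lop rho D j (Lop rho D k u)
    = (k - j)%:~R *: Lop rho D (k + j) u
      + ((k ^+ 3 - k)%:~R / 12%:R * (k + j == 0)%:R * r) *: u.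

Definition L1_derivative rho (DV : int -> {linear V -> tensor V V}) D : Prop :=
  forall u e,
    tmap (Lop rho DV 1) idfun (Ycoef D u e) = zderiv (Ycoef D u) e /\
    zderiv (Ycoef D u) e
    = Ycoef D (Lop rho D 1 u) e - tmap idfun (Lop rho D 1) (Ycoef D u e).

End CoactionAxioms.

Record gvoc (K : fieldType) := GVOC {
  voc_gr : int -> lmodType K ;
  voc_Delta : int -> {linear dsum voc_gr -> tensor (dsum voc_gr) (dsum voc_gr)} ;
  voc_c : {linear dsum voc_gr -> K^o} ;
  voc_rho : {linear dsum voc_gr -> K^o} ;
  voc_rank : K ;
  voc_finite_dim : forall s, finite_dim (voc_gr s) ;
  voc_bounded_below : exists N : int, forall s : int, s < N ->
    forall v : voc_gr s, v = 0 ;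
  voc_truncated : truncated voc_Delta ;
  voc_homogeneous : forall (k s : int) (v : voc_gr s),
    homogeneous (fun i j => i + j = s + k + 1) (voc_Delta k (inj v)) ;
  voc_left_counit : left_counit voc_c voc_Delta ;
  voc_right_counit_regular : forall v (e : int), e < 0 ->
    tcontr (dsum voc_gr) voc_c (Ycoef voc_Delta v e) = 0 ;
  voc_right_counit_limit : forall v,
    tcontr (dsum voc_gr) voc_c (Ycoef voc_Delta v 0) = v ;
  voc_jacobi : jacobi voc_Delta voc_Delta ;
  voc_virasoro : virasoro voc_rho voc_Delta voc_rank ;
  voc_L0 : forall (s : int) (v : dsum voc_gr),
    Lop voc_rho voc_Delta 0 v = s%:~R *: v <-> exists x : voc_gr s, v = inj x ;
  voc_L1_derivative : L1_derivative voc_rho voc_Delta voc_Delta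
}.

Definition voc_space (K : fieldType) (V : gvoc K) : lmodType K := dsum (voc_gr V).

Definition voc_L (K : fieldType) (V : gvoc K) (k : int) :
  {linear voc_space V -> voc_space V} := Lop (voc_rho V) (voc_Delta V) k.

(* rho is in V_2^*, i.e. it vanishes on the other homogeneous components *)
Definition rho_weight_two (K : fieldType) (V : gvoc K) : Prop :=
  forall s : int, s != 2 -> forall v : voc_gr V s, voc_rho V (inj v) = 0.

Record comod_data (K : fieldType) (V : gvoc K) := ComodData {
  comod_gr : nat -> lmodType K ;
  comod_Delta : int -> {linear dsum comod_gr -> tensor (voc_space V) (dsum comod_gr)}
}.

Definition comod_space (K : fieldType) (V : gvoc K) (M : comod_data V) : lmodType K :=
  dsum (comod_gr M).

Record admissible (K : fieldType) (V : gvoc K) (M : comod_data V) : Prop := Admissible {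
  comod_truncated : truncated (comod_Delta M) ;
  comod_left_counit : left_counit (voc_c V) (comod_Delta M) ;
  comod_jacobi : jacobi (voc_Delta V) (comod_Delta M) ;
  comod_virasoro : virasoro (voc_rho V) (comod_Delta M) (voc_rank V) ;
  comod_L1_derivative : L1_derivative (voc_rho V) (voc_Delta V) (comod_Delta M) ;
  comod_homogeneous : forall (k : int) (t : nat) (m : comod_gr M t),
    homogeneous (fun (i : int) (s : nat) => i = t%:Z + k + 1 - s%:Z)
      (comod_Delta M k (inj m))
}.

Definition comod_hom (K : fieldType) (V : gvoc K) (M1 M2 : comod_data V)
    (psi : {linear comod_space M1 -> comod_space M2}) : Prop :=
  forall m e, tmap idfun psi (Ycoef (comod_Delta M1) m e)
              = Ycoef (comod_Delta M2) (psi m) e.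

Definition comod_isomorphic (K : fieldType) (V : gvoc K) (M1 M2 : comod_data V) : Prop :=
  exists psi : {linear comod_space M1 -> comod_space M2},
    bijective psi /\ comod_hom psi.

Section Contragredient.
Variables (K : fieldType) (V : gvoc K).

(* The coefficient of z^a in (-z^-2)^L(0) e^(zL(-1)) v, an element of the direct
   product of the V_r.  On its component in V_r the first factor acts as
   (-1)^r z^(-2r), so only the term (z^n / n!) L(-1)^n v with n = a + 2r contributes. *)
Definition voc_twist (a : int) (v : voc_space V) : dprod (voc_gr V) := fun r =>
  if a + 2 * r is Posz n
  then ((-1) ^ r / n`!%:R) *: dsum_val (iter n (voc_L V (-1)) v) r
  else 0.

Lemma voc_twist_linear a : linear (voc_twist a).
Proof.
move=> x u v; apply/functional_extensionality_dep => r.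
rewrite dprodD dprodZ /voc_twist; case: (a + 2 * r) => n; last by rewrite scaler0 addr0.
have -> : iter n (voc_L V (-1)) (x *: u + v) =
    x *: iter n (voc_L V (-1)) u + iter n (voc_L V (-1)) v.
  by elim: n => [//|n IH]; rewrite !iterS IH linearP.
by rewrite [X in _ *: X = _]/(x *: _ + _) scalerDr !scalerA mulrC.
Qed.

HB.instance Definition _ a :=
  GRing.isLinear.Build K (voc_space V) (dprod (voc_gr V)) *:%R (voc_twist a)
    (voc_twist_linear a).

Variable M : comod_data V.

Local Notation M' := (dual_family (comod_gr M)).

(* The equation (Y'(z)m^*, f (x) m)
   = (f (x) m^*, ((-z^-2)^L(0) e^(zL(-1)) (x) Id) Y_M(z^-1) m),
   where the coefficient of z^e in the right-hand side is a finitely supported sum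
   over the power z^a coming from the twist and the power z^(e-a) coming from
   Y_M(z^-1)m. *)
Definition contragredient_eq
    (D : int -> {linear dsum M' -> tensor (voc_space V) (dsum M')}) : Prop :=
  forall (f : dsum (dual_family (voc_gr V))) (m : dsum (comod_gr M)) (m' : dsum M') e,
    tform (gform f) (geval m) (Ycoef D m' e)
    = \sum_(a \in [set: int])
        tform (gpair f \o voc_twist a) (gform m') (Ycoef (comod_Delta M) m (- (e - a))).

(* For M admissible with finite-dimensional M(t), the equation has exactly one
   solution, since V_s and M(t) are finite dimensional and V_s = 0 for s << 0. *)
Definition contragredient : comod_data V :=
  ComodData (xget (fun=> 0) [set D | contragredient_eq D]).

End Contragredient.

(* Main.v *)
From HB Require Import structures.
From mathcomp Require Import all_boot all_order all_algebra.
From mathcomp Require Import all_classical finmap zify ring.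
From mathcomp Require Import reals complex.
Require Import Defs.

Set Implicit Arguments.
Unset Strict Implicit.
Unset Printing Implicit Defensive.

Import Order.TTheory GRing.Theory.

Local Open Scope ring_scope.

(** The coefficientwise equation that defines the contragredient coaction involves
the operator T(z) = (-z^-2)^L(0) e^(zL(-1)) on V. Conjugating L(-1) by
(-z^-2)^L(0) multiplies it by -z^2, whence T(1/z) T(z) = e^(-zL(-1)) e^(zL(-1)) = Id.
Applying the contragredient construction twice therefore gives back the original
coaction, once a vector of M is read as a linear form on the restricted dual M'.

The computation uses the grading only through L(-1) raising weights by one
([voc_L_degree], where rho in V_2^* enters). As the weights of V are bounded below, a
homogeneous form f on V is then killed by all large powers of L(-1), so that the
right-hand side of the defining equation becomes a finite sum over the power n of L(-1)
([twisted_pairing_inj]). Iterating it gives a double sum over n and k whose terms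
depend on n + k only, apart from the coefficient (-1)^n / (n! k!); it reduces to its
term n + k = 0 ([triangular_exp_sum], [twisted_pairing_involutive]).

The contragredient is characterised by its defining equation: V' and M separate the
points of V (x) M' ([tform_separates]), and a bilinear form on V' x M that involves
finitely many weights comes from an element of V (x) M' ([tform_represents]), a weight
count showing that this is the case here ([contragredient_eq_exists]). By uniqueness, the
double contragredient is the coaction carried by M'' when that of M is transported along
the evaluation map M -> M'', which is bijective as the M(t) are finite dimensional. The
comodule axioms are stated with natural maps only, so they are transported too
([admissible_transport]). *)

(** * Linear maps and tensors *)

Section FiniteSupportSums.
Variables (K : fieldType) (U W : lmodType K) (T : choiceType).

(** Injectivity makes the two families have the same support; when it is infinite, both
sums are 0 by convention. *)
Lemma fsbig_inj_linear (g : {linear U -> W}) (k : T -> K) (F : T -> U) :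
  injective g ->
  g (\sum_(p \in [set: T]%classic) k p *: F p) =
  \sum_(p \in [set: T]%classic) k p *: g (F p).
Proof.
move=> g_inj.
have -> : finite_support 0 [set: T]%classic (fun p => k p *: g (F p)) =
          finite_support 0 [set: T]%classic (fun p => k p *: F p).
  rewrite /finite_support !locked_withE; congr (enum_fset (fset_set _)).
  rewrite eqEsubset; split=> p /= [_ nz]; split=> // e0; apply: nz.
    by rewrite -linearZ /= e0 linear0.
  by apply: g_inj; rewrite linearZ /= e0 linear0.
by rewrite linear_sum; apply: eq_bigr => p _; rewrite linearZ.
Qed.

End FiniteSupportSums.

Section LinearMaps.
Variable K : fieldType.
Implicit Types U W X : lmodType K.

Definition mk_linear U W (f : U -> W) (f_lin : linear f) : {linear U -> W} :=
  HB.pack f (GRing.isLinear.Build K U W *:%R f f_lin).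

Lemma iter_linear U (f : {linear U -> U}) n : linear (iter n f).
Proof. by move=> a x y; elim: n => // n IH; rewrite !iterS IH linearP. Qed.

Definition lin_iter U (f : {linear U -> U}) n : {linear U -> U} :=
  mk_linear (iter_linear f n).

Lemma tmap_comp U U1 U2 W W1 W2 (f1 : {linear U -> U1}) (f2 : {linear U1 -> U2})
    (g1 : {linear W -> W1}) (g2 : {linear W1 -> W2}) t :
  tmap f2 g2 (tmap f1 g1 t) = tmap (f2 \o f1) (g2 \o g1) t.
Proof.
elim/tensor_ind: t => [|u w t IH]; first by rewrite !linear0.
by rewrite !linearD IH !tmapE.
Qed.

Lemma eq_tmap U U1 W W1 (f f' : {linear U -> U1}) (g g' : {linear W -> W1}) t :
  f =1 f' -> g =1 g' -> tmap f g t = tmap f' g' t.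
Proof. by move=> /linear_ext -> /linear_ext ->. Qed.

Lemma tmap_id U W (t : tensor U W) : tmap idfun idfun t = t.
Proof.
elim/tensor_ind: t => [|u w t IH]; first by rewrite linear0.
by rewrite linearD IH tmapE.
Qed.

Lemma tassoc_tmap U W X X' (g : {linear X -> X'}) t :
  tassoc U W X' (tmap idfun (tmap idfun g) t) = tmap idfun g (tassoc U W X t).
Proof.
elim/tensor_ind: t => [|u t s IH]; first by rewrite !linear0.
rewrite !linearD IH; congr (_ + _); rewrite tmapE /=.
elim/tensor_ind: t => [|w x t IH']; first by rewrite !linear0.
by rewrite !linearD IH' tmapE !tassocE tmapE.
Qed.

Lemma tcontl_tmap U W W' (f : {linear U -> K^o}) (g : {linear W -> W'}) t :
  tcontl W' f (tmap idfun g t) = g (tcontl W f t).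
Proof.
elim/tensor_ind: t => [|u w t IH]; first by rewrite !linear0.
by rewrite !linearD IH tmapE !tcontlE linearZ.
Qed.

Lemma tcontl_linear U W (f g h : {linear U -> K^o}) a t :
  (forall u, h u = a * f u + g u) ->
  tcontl W h t = a *: tcontl W f t + tcontl W g t.
Proof.
move=> hE; elim/tensor_ind: t => [|u w t IH].
  by rewrite !linear0 addr0.
by rewrite !linearD IH !tcontlE hE scalerDl -scalerA addrACA.
Qed.

Lemma tcontl0 U W (f : {linear U -> K^o}) t : f =1 (fun=> 0) -> tcontl W f t = 0.
Proof.
move=> f0; elim/tensor_ind: t => [|u w t IH]; first by rewrite linear0.
by rewrite linearD IH tcontlE f0 scale0r addr0.
Qed.

Lemma tcontlZ U W (f h : {linear U -> K^o}) a t :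
  (forall u, h u = a * f u) -> tcontl W h t = a *: tcontl W f t.
Proof.
move=> hE; rewrite (@tcontl_linear _ _ f \0 h a) => [|u]; last by rewrite hE addr0.
by rewrite [X in _ + X]tcontl0 ?addr0.
Qed.

Lemma tformZ U W (f h : {linear U -> K^o}) (g : {linear W -> K^o}) a t :
  (forall u, h u = a * f u) -> tform h g t = a *: tform f g t.
Proof. by move=> hE; rewrite /tform /= (tcontlZ _ hE) linearZ. Qed.

Lemma tform_linearl U W (f g h : {linear U -> K^o}) (phi : {linear W -> K^o}) a t :
  (forall u, h u = a * f u + g u) ->
  tform h phi t = a *: tform f phi t + tform g phi t.
Proof. by move=> hE; rewrite /tform /= (tcontl_linear _ hE) linearP. Qed.

Lemma eq_tform U W (f f' : {linear U -> K^o}) (g g' : {linear W -> K^o}) t :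
  f =1 f' -> g =1 g' -> tform f g t = tform f' g' t.
Proof. by move=> /linear_ext -> /linear_ext ->. Qed.

Lemma tform_tmap U W W' (f : {linear U -> K^o}) (g : {linear W' -> K^o})
    (h : {linear W -> W'}) t :
  tform f g (tmap idfun h t) = tform f (g \o h) t.
Proof. by rewrite /tform /= tcontl_tmap. Qed.

Lemma sum_linE U W T (s : seq T) (f : T -> {linear U -> W}) u :
  (\sum_(p <- s) f p : {linear U -> W}) u = \sum_(p <- s) f p u.
Proof. by elim/big_rec2: _ => // p a b _ <-. Qed.

End LinearMaps.

(** * Frames of finite-dimensional spaces *)

Section Frames.
Variable K : fieldType.

(** A finite list of pairs (e, g) with u = sum of g(u) e plays the role of a basis with
its dual basis. Vectors are dropped from a spanning family as long as they satisfy a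
linear relation; when none is left, coordinates are unique, hence linear. *)
Lemma finite_dim_frame (U : lmodType K) : finite_dim U ->
  exists s : seq (U * {linear U -> K^o}), forall u, u = \sum_(p <- s) p.2 u *: p.1.
Proof.
move=> [n]; elim: n => [|n IH] [e span_e].
  by exists [::] => u; have [a ->] := span_e u; rewrite big_ord0 big_nil.
have [[a [j aj0 a_rel]]|free_e] := pselect
    (exists a : 'I_n.+1 -> K, exists2 j, a j != 0 & \sum_i a i *: e i = 0).
  (* a relation expresses e j through the other vectors *)
  apply: IH; exists (fun i => e (lift j i)) => u; have [b ->] := span_e u.
  exists (fun i => b (lift j i) - b j / a j * a (lift j i)).
  transitivity (\sum_i b i *: e i - (b j / a j) *: \sum_i a i *: e i).
    by rewrite a_rel scaler0 subr0.
  rewrite scaler_sumr -sumrB (bigD1_ord j) //= scalerA divfK // subrr add0r.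
  by apply: eq_bigr => i _; rewrite scalerA scalerBl.
have uniq_coord a b : \sum_i a i *: e i = \sum_i b i *: e i -> forall i, a i = b i.
  move=> eab i; apply/eqP; rewrite -subr_eq0; apply/negP => nz; apply: free_e.
  exists (fun i => a i - b i); exists i; first exact/negP.
  under eq_bigr do rewrite scalerBl.
  by rewrite sumrB eab subrr.
have [a aE] := choice span_e.
have a_lin i : linear (fun u => a u i : K^o).
  move=> c u v; apply: uniq_coord (a (c *: u + v)) (fun i => c * a u i + a v i) _ i.
  rewrite -aE; under eq_bigr do rewrite scalerDl -scalerA.
  by rewrite big_split -scaler_sumr -!aE.
exists [seq (e i, mk_linear (a_lin i)) | i <- enum 'I_n.+1] => u.
by rewrite big_map big_enum [LHS]aE.
Qed.

End Frames.

(** * Direct sums and restricted duals *)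

Section DirectSums.
Variables (K : fieldType) (I : choiceType) (F : I -> lmodType K).
Implicit Types (x y : dsum F) (i j : I).

Lemma dsumP x y : (forall i, dsum_val x i = dsum_val y i) -> x = y.
Proof. by move=> exy; apply/val_inj/functional_extensionality_dep. Qed.

Lemma injE i (u : F i) : dsum_val (inj u) i = u.
Proof. exact: dfwith_in. Qed.

Lemma inj_out i j (u : F i) : j != i -> dsum_val (inj u) j = 0.
Proof. by move=> ji; apply: dfwith_out; rewrite eq_sym. Qed.

Lemma dsum_val_linear i : linear (fun x => dsum_val x i).
Proof. by []. Qed.

Definition component i : {linear dsum F -> F i} := mk_linear (dsum_val_linear i).

Lemma inj_is_linear i : linear (@inj K I F i).
Proof.
move=> a u v; apply: dsumP => j.
rewrite -[RHS]/(a *: dsum_val (inj u) j + dsum_val (inj v) j).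
have [->|ji] := eqVneq j i; first by rewrite !injE.
by rewrite !inj_out // scaler0 addr0.
Qed.

Definition linj i : {linear F i -> dsum F} := mk_linear (inj_is_linear (i := i)).

Definition dproj i : {linear dsum F -> dsum F} := linj i \o component i.

Lemma dprojE i x : dproj i x = inj (dsum_val x i). Proof. by []. Qed.

Lemma dproj_inj i j (u : F i) : dproj j (inj u) = if j == i then inj u else 0.
Proof.
rewrite dprojE; case: eqVneq => [->|ji]; first by rewrite injE.
by rewrite inj_out // -[LHS]/(linj j 0) linear0.
Qed.

Lemma dsum_support x : exists A : {fset I}, forall i, i \notin A -> dsum_val x i = 0.
Proof.
have fin_x : finite_set [set i | dsum_val x i != 0]%classic.
  by have /asboolP := valP x.
exists (fset_set [set i | dsum_val x i != 0]%classic) => i.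
by rewrite in_fset_set // notin_setE /= => /negP; rewrite negbK => /eqP.
Qed.

Lemma dproj_val i j x : dsum_val (dproj i x) j = if i == j then dsum_val x j else 0.
Proof.
rewrite dprojE; case: eqVneq => [->|ij]; first by rewrite injE.
by rewrite inj_out // eq_sym.
Qed.

Lemma sum_dproj (A : {fset I}) x : (forall i, i \notin A -> dsum_val x i = 0) ->
  \sum_(i <- A) dproj i x = x.
Proof.
move=> xA; apply: dsumP => j; rewrite -[LHS]/(component j _) linear_sum.
under eq_bigr do rewrite -[component j _]/(dsum_val _ j) dproj_val.
have [jA|jA] := boolP (j \in A).
  rewrite (big_fsetD1 j) //= eqxx big1_fset ?addr0 // => i.
  by rewrite !inE => /andP[/negPf ->].
rewrite xA // big1_fset // => i iA _; case: eqVneq => // ij.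
Qed.

Lemma dsum_ind (P : dsum F -> Prop) :
  P 0 -> (forall i (u : F i) x, P x -> P (inj u + x)) -> forall x, P x.
Proof.
move=> P0 PD x; have [A /sum_dproj <-] := dsum_support x.
by elim/big_rec: _ => // i y _ Py; apply: PD.
Qed.

Lemma linear_dsum_ext (W : lmodType K) (f g : {linear dsum F -> W}) :
  (forall i (u : F i), f (inj u) = g (inj u)) -> f =1 g.
Proof.
move=> fg; elim/dsum_ind => [|i u x IH]; first by rewrite !linear0.
by rewrite !linearD fg IH.
Qed.

Lemma linear_sum_dproj (W : lmodType K) (f : {linear dsum F -> W}) (A : {fset I}) x :
  (forall i (u : F i), i \notin A -> f (inj u) = 0) ->
  f (\sum_(i <- A) dproj i x) = f x.
Proof.
move=> fA; elim/dsum_ind: x => [|i u x IH].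
  by rewrite big1 // => i _; rewrite linear0.
under eq_bigr do rewrite linearD.
rewrite big_split !linearD IH; congr (_ + _); rewrite linear_sum.
under eq_bigr do rewrite dproj_inj.
have [iA|iA] := boolP (i \in A).
  rewrite (big_fsetD1 i) //= eqxx big1_fset ?addr0 // => j.
  by rewrite !inE => /andP[/negPf -> _] _; rewrite linear0.
rewrite fA // big1_fset // => j jA _; case: eqVneq => [ji|]; last by rewrite linear0.
by rewrite fA.
Qed.

End DirectSums.

Arguments component {K I F} i.
Arguments linj {K I F} i.
Arguments dproj {K I F} i.

Section RestrictedDual.
Variables (K : fieldType) (I : choiceType) (F : I -> lmodType K).
Local Notation gdual := (dsum (dual_family F)).
Implicit Types (x : dsum F) (f : gdual) (i : I).

Lemma gpair_inj i (g : dual_family F i) (x : dprod F) :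
  gpair (inj g) x = (g : {linear F i -> K^o}) (x i).
Proof.
rewrite (@gpairE _ _ _ [fset i]%fset) ?big_seq_fset1 ?injE // => j.
by rewrite inE; exact: inj_out.
Qed.

Lemma geval_inj i (u : F i) f :
  geval (inj u) f = (dsum_val f i : {linear F i -> K^o}) u.
Proof.
elim/dsum_ind: f => [|j g f IH]; first by rewrite linear0.
transitivity (geval (inj u) (inj g) + geval (inj u) f); first exact: linearD.
rewrite {}IH; congr (_ + _); rewrite -[LHS]/(gpair (inj g) (dsum_val (inj u))) gpair_inj.
rewrite -[RHS]/((dsum_val (inj g) i : {linear F i -> K^o}) u).
move: u g; have [->|ji] := eqVneq i j => u g; first by rewrite !injE.
by rewrite (inj_out u) 1?eq_sym // (inj_out g) // linear0.
Qed.

Lemma gform_inj i (g : dual_family F i) x :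
  gform (inj g) x = (g : {linear F i -> K^o}) (dsum_val x i).
Proof. exact: gpair_inj. Qed.

End RestrictedDual.

Lemma homogeneous_tform_eq0 (K : fieldType) (I J : choiceType) (F : I -> lmodType K)
    (G : J -> lmodType K) (P : I -> J -> Prop) (t : tensor (dsum F) (dsum G))
    (f : {linear dsum F -> K^o}) (g : {linear dsum G -> K^o}) :
  homogeneous P t ->
  (forall i j (x : F i) (y : G j), P i j -> f (inj x) = 0 \/ g (inj y) = 0) ->
  tform f g t = 0.
Proof.
move=> homt fg0; elim: homt => [|i j x y {}t ij _ IH]; first by rewrite linear0.
by rewrite linearD IH tformE; case: (fg0 i j x y ij) => ->; rewrite ?mul0r ?mulr0 addr0.
Qed.

Section RestrictedDualFrames.
Variables (K : fieldType) (I : choiceType) (F : I -> lmodType K).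
Hypothesis F_fin : forall i, finite_dim (F i).
Local Notation gdual := (dsum (dual_family F)).

(** Frames of the components in A are concatenated. The same list expands the vectors and
the forms supported in A, with the roles of its two entries exchanged. *)
Lemma gdual_frame (A : seq I) : exists s : seq (dsum F * gdual),
  (forall x, \sum_(p <- s) (gform p.2 x : K) *: p.1 = \sum_(i <- A) dproj i x) /\
  (forall f, \sum_(p <- s) (gform f p.1 : K) *: p.2 = \sum_(i <- A) dproj i f).
Proof.
elim: A => [|i A [s [sx sf]]].
  by exists [::]; split=> ?; rewrite !big_nil.
have [t tE] := finite_dim_frame (F_fin i).
exists ([seq (inj p.1, inj (p.2 : dual_family F i)) | p <- t] ++ s).
split=> [x|f]; rewrite big_cat big_map big_cons ?sx ?sf; congr (_ + _).
  rewrite dprojE [in RHS](tE (dsum_val x i)) -[RHS]/(linj i _) linear_sum.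
  by apply: eq_bigr => p _; rewrite gform_inj linearZ.
rewrite dprojE -[RHS]/(linj i _).
have -> : dsum_val f i =
    \sum_(p <- t) (gform f (inj p.1) : K) *: (p.2 : dual_family F i).
  apply: linear_ext => u; rewrite [in LHS](tE u) linear_sum sum_linE.
  apply: eq_bigr => p _; rewrite linearZ -[gform f _]/(geval (inj p.1) f) geval_inj.
  by rewrite [LHS]mulrC.
by rewrite linear_sum; apply: eq_bigr => p _; rewrite linearZ.
Qed.

Lemma gform_separates (x : dsum F) : (forall f, gform f x = 0) -> x = 0.
Proof.
move=> x0; have [A xA] := dsum_support x; have [s [sx _]] := gdual_frame A.
by rewrite -(sum_dproj xA) -sx big1 // => p _; rewrite x0 scale0r.
Qed.

Lemma geval_separates (f : gdual) : (forall x, geval x f = 0) -> f = 0.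
Proof.
move=> f0; apply: dsumP => i; apply: linear_ext => u.
by have := f0 (inj u); rewrite geval_inj.
Qed.

(** A tensor involves finitely many components of its first factor. A frame of these acts
on them as the identity, which writes t as the sum of the e (x) (g (x) Id)(t). *)
Lemma tcontl_separates (W : lmodType K) (t : tensor (dsum F) W) :
  (forall f, tcontl W (gform f) t = 0) -> t = 0.
Proof.
move=> t0.
have [A tA] : exists A : {fset I}, forall s : seq (dsum F * gdual),
    (forall x, (forall i, i \notin A -> dsum_val x i = 0) ->
       \sum_(p <- s) (gform p.2 x : K) *: p.1 = x) ->
    t = \sum_(p <- s) tens p.1 (tcontl W (gform p.2) t).
  elim/tensor_ind: {t0} t => [|u w t [A IH]].
    by exists fset0 => s _; rewrite big1 // => p _; rewrite !linear0.
  have [B uB] := dsum_support u; exists (A `|` B)%fset => s sE.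
  under eq_bigr do rewrite !linearD tcontlE linearZ.
  rewrite big_split -IH => [|x xA]; last first.
    by apply: sE => i; rewrite inE negb_or => /andP[/xA].
  congr (_ + _); rewrite -{1}(sE u) => [|i]; last first.
    by rewrite inE negb_or => /andP[_ /uB].
  elim: (s) => [|p s' IHs]; last by rewrite !big_cons tensPl IHs.
  by rewrite !big_nil linear0l.
have [s [sx _]] := gdual_frame A.
rewrite (tA s) => [|x xA]; last by rewrite sx sum_dproj.
by rewrite big1 // => p _; rewrite t0 linear0.
Qed.

End RestrictedDualFrames.

Section Representation.
Variables (K : fieldType) (I J : choiceType).
Variables (F : I -> lmodType K) (G : J -> lmodType K).
Hypothesis F_fin : forall i, finite_dim (F i).
Hypothesis G_fin : forall j, finite_dim (G j).
Local Notation F' := (dsum (dual_family F)).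
Local Notation G' := (dsum (dual_family G)).

Lemma tform_separates (t t' : tensor (dsum F) G') :
  (forall f x, tform (gform f) (geval x) t = tform (gform f) (geval x) t') -> t = t'.
Proof.
move=> tt'; apply/subr0_eq/(tcontl_separates F_fin) => f.
apply: geval_separates => x.
by rewrite -[geval x _]/(tform (gform f) (geval x) _) linearB tt' subrr.
Qed.

(** With frames (e_p, g_p) over A and (y_q, h_q) over B, the tensor is the sum of the
phi(g_p, y_q) e_p (x) h_q. *)
Lemma tform_represents (phi : F' -> dsum G -> K^o) (A : {fset I}) (B : {fset J}) :
  (forall x, linear (phi^~ x)) -> (forall f, linear (phi f)) ->
  (forall i (g : dual_family F i) x, i \notin A -> phi (inj g) x = 0) ->
  (forall f j (u : G j), j \notin B -> phi f (inj u) = 0) ->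
  exists t : tensor (dsum F) G', forall f x, tform (gform f) (geval x) t = phi f x.
Proof.
move=> linl linr phiA phiB.
have [s [_ sE]] := gdual_frame F_fin A; have [r [rE _]] := gdual_frame G_fin B.
exists (\sum_(p <- s) \sum_(q <- r) (phi p.2 q.1 : K) *: tens p.1 q.2) => f x.
have -> : phi f x = phi (\sum_(i <- A) dproj i f) (\sum_(j <- B) dproj j x).
  rewrite -[RHS]/(mk_linear (linl _) _) linear_sum_dproj => [|i g]; last exact: phiA.
  by rewrite -[RHS]/(mk_linear (linr f) _) linear_sum_dproj // => j u; exact: phiB.
rewrite -sE -rE linear_sum -[RHS]/(mk_linear (linl _) _) linear_sum.
apply: eq_bigr => p _; rewrite linear_sum linearZ.
rewrite -[X in _ = _ *: X]/(mk_linear (linr p.2) _) linear_sum scaler_sumr.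
apply: eq_bigr => q _; rewrite !linearZ tformE /=.
rewrite -[LHS]/(phi p.2 q.1 * (gform f p.1 * gform q.2 x)).
by rewrite mulrC -mulrA mulrCA.
Qed.

End Representation.

(** * A graded space and its double dual *)

Section DoubleDual.
Variables (K : fieldType) (I : choiceType) (F : I -> lmodType K).
Local Notation F'' := (dual_family (dual_family F)).

Lemma eval_linear i (u : F i) : linear (fun g : dual_family F i => g u : K^o).
Proof. by []. Qed.

Definition eval_form i (u : F i) : F'' i := mk_linear (eval_linear u).

Lemma eval_form_is_linear i : linear (@eval_form i).
Proof. by move=> a u v; apply: linear_ext => g; exact: linearP. Qed.

Lemma bidual_support (x : dsum F) :
  (fun i => eval_form (dsum_val x i)) \in @finsupp K I F''.
Proof.
have /asboolP := valP x => fx; apply/asboolP; apply: sub_finite_set fx => i /=.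
apply: contra_neq => ->; apply: linear_ext => g.
exact: (linear0 (g : {linear F i -> K^o})).
Qed.

Definition bidual (x : dsum F) : dsum F'' := DSum (bidual_support x).

Lemma bidual_is_linear : linear bidual.
Proof. by move=> a x y; apply: dsumP => i; exact: eval_form_is_linear. Qed.

Definition to_bidual : {linear dsum F -> dsum F''} := mk_linear bidual_is_linear.

Lemma gform_to_bidual x : gform (to_bidual x) =1 geval x.
Proof. by []. Qed.

Lemma to_bidual_inj i (u : F i) : to_bidual (inj u) = inj (eval_form u).
Proof.
apply: dsumP => j; rewrite -[LHS]/(eval_form (dsum_val (inj u) j)).
have [->|ji] := eqVneq j i; first by rewrite !injE.
by rewrite !inj_out // -[LHS]/(mk_linear (@eval_form_is_linear j) 0) linear0.
Qed.

Hypothesis F_fin : forall i, finite_dim (F i).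

(** The form phi is the evaluation at the sum of the phi(g) e over a frame (e, g). *)
Lemma eval_form_surj i (phi : F'' i) : exists u, phi = eval_form u.
Proof.
have [s sE] := finite_dim_frame (F_fin i).
exists (\sum_(p <- s) (phi p.2 : K) *: p.1); apply: linear_ext => g.
rewrite -[RHS]/(g _) linear_sum.
have gE : g = \sum_(p <- s) (g p.1 : K) *: (p.2 : dual_family F i).
  apply: linear_ext => u; rewrite [in LHS](sE u) linear_sum sum_linE.
  by apply: eq_bigr => p _; rewrite linearZ [LHS]mulrC.
rewrite [in LHS]gE linear_sum; apply: eq_bigr => p _.
by rewrite !linearZ [LHS]mulrC.
Qed.

Lemma to_bidual_bij : bijective to_bidual.
Proof.
have surj y : exists x, to_bidual x = y.
  elim/dsum_ind: y => [|i phi y [x xy]]; first by exists 0; rewrite linear0.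
  have [u ->] := eval_form_surj phi.
  by exists (inj u + x); rewrite linearD to_bidual_inj xy.
have [g gK] := choice surj; exists g => // x.
apply/subr0_eq/(gform_separates F_fin) => f.
rewrite -[LHS]/(geval _ f) -gform_to_bidual linearB gK subrr.
exact: (linear0 (geval f)).
Qed.

End DoubleDual.

Arguments to_bidual {K I F}.

(** * The operator L(-1) and the twist *)

Section Twist.
Variables (K : fieldType) (V : gvoc K).
Hypothesis rho_V2 : rho_weight_two V.
Local Notation L := (voc_L V (-1)).

(** L(-1) contracts with rho the first factor of Delta_2, which raises the total weight
by 3; the factor that rho sees has weight 2. *)
Lemma voc_L_degree s v : L (dproj s v) = dproj (s + 1) (L v).
Proof.
have L_inj i (x : voc_gr V i) : dproj (i + 1) (L (inj x)) = L (inj x).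
  rewrite -[L _]/(tcontl (dsum (voc_gr V)) (voc_rho V) (voc_Delta V (1 - -1) (inj x))).
  elim: (@voc_homogeneous K V (1 - -1) i x) => [|j k y z t jk _ IH].
    by rewrite !linear0.
  rewrite !linearD IH tcontlE; congr (_ + _).
  have [j2|j2] := eqVneq j 2; last by rewrite rho_V2 // scale0r linear0.
  have -> : i + 1 = k by move: jk; rewrite j2; lia.
  by rewrite linearZ dproj_inj eqxx.
apply: (@linear_dsum_ext _ _ _ _ (L \o dproj s) (dproj (s + 1) \o L)) v => i x.
rewrite -[LHS]/(L (dproj s (inj x))) -[RHS]/(dproj (s + 1) (L (inj x))) dproj_inj.
have [->|si] := eqVneq s i; first by rewrite L_inj.
rewrite -L_inj; apply: dsumP => j; rewrite !dproj_val linear0.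
by case: eqVneq => // sj; case: eqVneq => // ij; lia.
Qed.

Lemma voc_L_iter_degree n s v :
  iter n L (dproj s v) = dproj (s + n%:Z) (iter n L v).
Proof.
elim: n s v => [|n IH] s v; first by rewrite addr0.
by rewrite !iterS IH voc_L_degree; congr (dproj _ _); lia.
Qed.

Variable N : int.
Hypothesis V_bounded : forall s : int, s < N -> forall v : voc_gr V s, v = 0.

Lemma dsum_val_voc_L_iter n r v :
  dsum_val (iter n L v) r = dsum_val (iter n L (dproj (r - n%:Z) v)) r.
Proof. by rewrite voc_L_iter_degree subrK dproj_val eqxx. Qed.

(** Pairings with T(z) are finite sums for this reason: a form of weight r is killed by
L(-1)^n as soon as r - n < N. *)
Lemma voc_L_iter_eq0 n r v : (r - n%:Z < N)%R -> dsum_val (iter n L v) r = 0.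
Proof.
move=> rn; rewrite dsum_val_voc_L_iter dprojE (V_bounded rn (dsum_val v _)).
by rewrite -[inj 0]/(linj _ 0) linear0 -[iter n L 0]/(lin_iter L n 0) linear0.
Qed.

(** The transpose of L(-1)^n preserves the restricted dual, so the pairing with T(z) can
be applied again to the forms f L(-1)^n. *)
Lemma voc_L_iter_dual n r (f : dual_family (voc_gr V) r) :
  exists g : dual_family (voc_gr V) (r - n%:Z),
    forall v, gform (inj g) v = gform (inj f) (iter n L v).
Proof.
exists ((f : {linear voc_gr V r -> K^o}) \o component r \o lin_iter L n
        \o linj (r - n%:Z) : {linear _ -> K^o}) => v.
by rewrite !gform_inj dsum_val_voc_L_iter.
Qed.

Lemma gpair_voc_twist r (f : dual_family (voc_gr V) r) a v :
  gpair (inj f) (voc_twist a v) =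
  if a + 2 * r is Posz n then (-1) ^ r / n`!%:R * gform (inj f) (iter n L v) else 0.
Proof.
rewrite gpair_inj /voc_twist; case: (a + 2 * r) => n; last by rewrite linear0.
by rewrite linearZ gform_inj.
Qed.

End Twist.

(** * Existence and uniqueness of the contragredient coaction *)

Lemma gpair_linearl (K : fieldType) (I : choiceType) (F : I -> lmodType K)
    (x : dprod F) : linear (fun f : dsum (dual_family F) => gpair f x).
Proof.
move=> a f g; have [A fA] := dsum_support f; have [B gB] := dsum_support g.
have fE i : i \notin (A `|` B)%fset -> dsum_val f i = 0.
  by rewrite inE negb_or => /andP[/fA].
have gE i : i \notin (A `|` B)%fset -> dsum_val g i = 0.
  by rewrite inE negb_or => /andP[_ /gB].
rewrite (gpairE _ fE) (gpairE _ gE) (@gpairE _ _ _ (A `|` B)%fset) => [|i iA].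
  by rewrite scaler_sumr -big_split.
by rewrite -[LHS]/(a *: dsum_val f i + dsum_val g i) fE // gE // scaler0 addr0.
Qed.

Section TwistedPairing.
Variables (K : fieldType) (V : gvoc K) (M : comod_data V).
Hypothesis rho_V2 : rho_weight_two V.
Variable N : int.
Hypothesis V_bounded : forall s : int, s < N -> forall v : voc_gr V s, v = 0.
Local Notation L := (voc_L V (-1)).
Local Notation D := (comod_Delta M).
Local Notation V' := (dsum (dual_family (voc_gr V))).
Local Notation M' := (dsum (dual_family (comod_gr M))).

(** The coefficient of z^e in (f (x) m^*, (T(z) (x) Id) Y_M(z^-1) m). *)
Definition twisted_pairing e (f : V') (m : dsum (comod_gr M)) (m' : M') : K^o :=
  \sum_(a \in [set: int]%classic)
    tform (gpair f \o voc_twist a) (gform m') (Ycoef D m (- (e - a))).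

(** For a form g of weight r, the coefficient of z^a in g T(z) is a multiple of g L(-1)^n
with n = a + 2r, which is nonzero only for 0 <= n <= r - N. *)
Lemma voc_twist_support (f : V') :
  exists A : {fset int}, forall a, a \notin A -> forall v, gpair f (voc_twist a v) = 0.
Proof.
elim/dsum_ind: f => [|r g f [A fA]].
  by exists fset0 => a _ v; rewrite -[LHS]/(mk_linear (gpair_linearl _) 0) linear0.
pose B := [fset n%:Z - 2 * r | n in iota 0 `|r - N|.+1]%fset.
exists (B `|` A)%fset => a; rewrite inE negb_or => /andP[aB /fA fa0] v.
rewrite -[LHS]/(mk_linear (gpair_linearl _) (inj g + f)) linearD /= fa0 addr0.
rewrite gpair_voc_twist; case an: (a + 2 * r) => [n|//].
rewrite gform_inj (voc_L_iter_eq0 rho_V2 V_bounded) ?linear0 ?mulr0 //.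
rewrite ltNge; apply: contra aB => nr; apply/imfsetP; exists n => /=; last by lia.
by rewrite inE mem_iota; lia.
Qed.

Lemma twisted_pairingE (A : {fset int}) e f m m' :
  (forall a, a \notin A -> forall v, gpair f (voc_twist a v) = 0) ->
  twisted_pairing e f m m' =
  \sum_(a <- A) gform m' (tcontl _ (gpair f \o voc_twist a) (Ycoef D m (- (e - a)))).
Proof. by move=> fA; apply: fsbigTE => a /fA fa; rewrite /= tcontl0 // linear0. Qed.

Lemma twisted_pairing_linear_f e m m' : linear (fun f => twisted_pairing e f m m').
Proof.
move=> c f g; have [A fA] := voc_twist_support f; have [B gB] := voc_twist_support g.
have tw a v : gpair (c *: f + g) (voc_twist a v) =
    c * gpair f (voc_twist a v) + gpair g (voc_twist a v) by exact: gpair_linearl.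
have fE a : a \notin (A `|` B)%fset -> forall v, gpair f (voc_twist a v) = 0.
  by rewrite inE negb_or => /andP[/fA].
have gE a : a \notin (A `|` B)%fset -> forall v, gpair g (voc_twist a v) = 0.
  by rewrite inE negb_or => /andP[_ /gB].
rewrite (twisted_pairingE _ _ _ fE) (twisted_pairingE _ _ _ gE).
rewrite (@twisted_pairingE (A `|` B)%fset) => [|a aAB v]; last first.
  by rewrite tw fE // gE // mulr0 addr0.
rewrite scaler_sumr -big_split; apply: eq_bigr => a _.
by rewrite (@tcontl_linear _ _ _ (gpair f \o voc_twist a) (gpair g \o voc_twist a)
  (gpair (c *: f + g) \o voc_twist a) _ _ (tw a)) linearP.
Qed.

Lemma twisted_pairing_linear_m e f m' : linear (fun m => twisted_pairing e f m m').
Proof.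
move=> c m1 m2; have [A fA] := voc_twist_support f.
rewrite !(twisted_pairingE _ _ _ fA) scaler_sumr -big_split.
by apply: eq_bigr => a _; rewrite {1}/Ycoef !linearP.
Qed.

Lemma twisted_pairing_linear_m' e f m : linear (twisted_pairing e f m).
Proof.
move=> c m1 m2; have [A fA] := voc_twist_support f.
rewrite !(twisted_pairingE _ _ _ fA) scaler_sumr -big_split.
by apply: eq_bigr => a _; exact: gpair_linearl.
Qed.

(** Any P beyond r - N is allowed as a bound, so that a convenient one can be chosen in
each use: 0 when r < N, and P - n for forms of weight r - n. *)
Lemma twisted_pairing_inj e r (g : dual_family (voc_gr V) r) m m' P :
  (r - P%:Z < N)%R ->
  twisted_pairing e (inj g) m m' =
  \sum_(n < P) ((-1) ^ r / n`!%:R : K) *: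
    tform (gform (inj g) \o lin_iter L n) (gform m') (Ycoef D m (n%:Z - 2 * r - e)).
Proof.
move=> rP; rewrite /twisted_pairing.
pose s := [seq n%:Z - 2 * r | n <- iota 0 P].
have s_uniq : uniq s by rewrite map_inj_uniq ?iota_uniq // => i j; lia.
rewrite -(fsbig_widen [set` s]%classic) //; last first.
  move=> a [_ as_] /=; rewrite tcontl0 ?linear0 // => v /=.
  rewrite gpair_voc_twist; case an: (a + 2 * r) => [n|//].
  rewrite gform_inj (voc_L_iter_eq0 rho_V2 V_bounded) ?linear0 ?mulr0 //.
  rewrite ltNge; apply/negP => nr; apply: as_ => /=; apply/mapP; exists n; last by lia.
  by rewrite mem_iota; lia.
rewrite -fsbig_seq // big_map -[P]subn0 -/(index_iota 0 P) big_mkord subn0.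
apply: eq_bigr => n _.
have -> : - (e - (n%:Z - 2 * r)) = n%:Z - 2 * r - e by lia.
apply: tformZ => v; rewrite -[LHS]/(gpair (inj g) (voc_twist _ v)) gpair_voc_twist.
by have -> : n%:Z - 2 * r + 2 * r = n by lia.
Qed.

Section Homogeneity.
Hypothesis M_homogeneous : forall (k : int) (t : nat) (m : comod_gr M t),
    homogeneous (fun (i : int) (s : nat) => i = t%:Z + k + 1 - s%:Z) (D k (inj m)).

(** The V-factor of the coefficient of z^(n - 2r - e) in Y_M(z) x has weight
s + e + 2r - n - t when its other factor has weight t, and L(-1)^n adds n to it. This has
to be the weight r of g, that is, r = t - s - e. *)
Lemma twisted_pairing_eq0 e r (g : dual_family (voc_gr V) r)
    s (x : comod_gr M s) t (u : dual_family (comod_gr M) t) :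
  (r < N)%R || (r != t%:Z - s%:Z - e) ->
  twisted_pairing e (inj g) (inj x) (inj u) = 0.
Proof.
case: (ltP r N) => [rN _|_ /= rts].
  by rewrite (@twisted_pairing_inj _ _ _ _ _ 0) ?big_ord0 //; lia.
have [P rP] : exists P : nat, (r - P%:Z < N)%R by exists `|r - N|.+1; lia.
rewrite (twisted_pairing_inj _ _ _ _ rP) big1 // => n _.
rewrite (homogeneous_tform_eq0 (M_homogeneous _ x)) ?scaler0 // => i j y z ij.
have [jt|jt] := eqVneq t j; last first.
  by right; rewrite -[LHS]/(gform (inj u) (inj z)) gform_inj inj_out ?linear0.
left; rewrite -[LHS]/(gform (inj g) (iter n L (inj y))) gform_inj.
rewrite (dsum_val_voc_L_iter rho_V2) dproj_inj.
case: eqVneq => [ri|_]; first by move: rts; rewrite ij in ri; lia.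
by rewrite -[iter n L 0]/(lin_iter L n 0) !linear0.
Qed.

Hypothesis V_fin : forall s, finite_dim (voc_gr V s).
Hypothesis M_fin : forall t, finite_dim (comod_gr M t).

(** Since s >= 0 and r >= N, the relation r = t - s - e leaves finitely many weights. *)
Lemma twisted_pairing_represented e m' :
  exists T, forall f m, tform (gform f) (geval m) T = twisted_pairing e f m m'.
Proof.
elim/dsum_ind: m' => [|t u m' [T TE]].
  exists 0 => f m; rewrite linear0.
  by rewrite -[RHS]/(mk_linear (twisted_pairing_linear_m' e f m) 0) linear0.
have [T' T'E] : exists T', forall f m,
    tform (gform f) (geval m) T' = twisted_pairing e f m (inj u).
  pose A := [fset (N + k%:Z)%R | k in iota 0 `|(t%:Z - e - N)%R|.+1]%fset.
  pose B := [fset k | k in iota 0 `|(t%:Z - e - N)%R|.+1]%fset.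
  refine (@tform_represents _ _ _ _ _ V_fin M_fin
    (fun f m => twisted_pairing e f m (inj u)) A B _ _ _ _).
  - by move=> m; exact: twisted_pairing_linear_f.
  - by move=> f; exact: twisted_pairing_linear_m.
  - move=> r g m rA.
    apply: (@linear_dsum_ext _ _ _ _
      (mk_linear (twisted_pairing_linear_m e (inj g) (inj u))) \0) => s x.
    apply: twisted_pairing_eq0; apply: contraNT rA.
    rewrite negb_or negbK => /andP[rN /eqP rts].
    apply/imfsetP; exists `|r - N|%N => /=; last by lia.
    by rewrite inE mem_iota; lia.
  - move=> f s x sB; move: f.
    apply: (@linear_dsum_ext _ _ _ _
      (mk_linear (twisted_pairing_linear_f e (inj x) (inj u))) \0) => r g.
    apply: twisted_pairing_eq0; apply: contraNT sB.
    rewrite negb_or negbK => /andP[rN /eqP rts].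
    by apply/imfsetP; exists s => //=; rewrite inE mem_iota; lia.
exists (T' + T) => f m; rewrite linearD T'E TE.
by rewrite -[RHS]/(mk_linear (twisted_pairing_linear_m' e f m) (inj u + m')) linearD.
Qed.

(** The representing tensor depends linearly on m^* because it is unique. *)
Lemma contragredient_eq_exists : exists D', @contragredient_eq K V M D'.
Proof.
have [T TE] := choice (fun em => twisted_pairing_represented em.1 em.2).
have T_lin e : linear (fun m' => T (e, m')).
  move=> a m1 m2; apply: (tform_separates V_fin) => f m.
  rewrite TE linearP !TE.
  by rewrite -[LHS]/(mk_linear (twisted_pairing_linear_m' e f m) _) linearP.
(* Delta_k is the coefficient of z^(-k-1) *)
exists (fun k => mk_linear (T_lin (- k - 1))) => f m m' e.
rewrite /Ycoef /=; have -> : - (- e - 1) - 1 = e by lia.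
exact: TE (e, m') f m.
Qed.

End Homogeneity.

End TwistedPairing.

Lemma contragredient_eq_unique (K : fieldType) (V : gvoc K) (M : comod_data V) D1 D2 :
  @contragredient_eq K V M D1 -> @contragredient_eq K V M D2 -> D1 = D2.
Proof.
move=> eq1 eq2; apply/funext => k; apply: linear_ext => m'.
apply: (tform_separates (@voc_finite_dim K V)) => f m.
have := eq1 f m m' (- k - 1); rewrite -eq2 /Ycoef.
by have -> : - (- k - 1) - 1 = k by lia.
Qed.

Lemma contragredientE (K : fieldType) (V : gvoc K) (M : comod_data V) D' :
  @contragredient_eq K V M D' -> contragredient M = ComodData D'.
Proof.
move=> eqD; congr ComodData; apply: xget_subset1 => // D1 D2.
exact: contragredient_eq_unique.
Qed.

(** * Transport of comodule structures *)

Section FormalProducts.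
Variables (K : fieldType) (U W : lmodType K) (g : {linear U -> W}).
Hypothesis g_inj : injective g.

Lemma zmul12_inj_linear k (F : int -> int -> U) (G : int -> int -> W) a b c :
  (forall e1 e2, G e1 e2 = g (F e1 e2)) -> zmul12 k G a b c = g (zmul12 k F a b c).
Proof.
move=> GE; rewrite /zmul12 fsbig_inj_linear //.
by apply: eq_fsbigr => p _; rewrite GE.
Qed.

Lemma zmul02_inj_linear k (F : int -> int -> U) (G : int -> int -> W) a b c :
  (forall e0 e2, G e0 e2 = g (F e0 e2)) -> zmul02 k G a b c = g (zmul02 k F a b c).
Proof.
move=> GE; rewrite /zmul02 fsbig_inj_linear //.
by apply: eq_fsbigr => p _; rewrite GE.
Qed.

End FormalProducts.

Section Transport.
Variables (K : fieldType) (V : gvoc K) (M1 M2 : comod_data V).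
Variables (f : {linear comod_space M1 -> comod_space M2})
          (g : {linear comod_space M2 -> comod_space M1}).
Hypotheses (fK : cancel f g) (gK : cancel g f).
Hypothesis f_hom : forall k m, tmap idfun f (comod_Delta M1 k m) = comod_Delta M2 k (f m).

Lemma comod_hom_inv : comod_hom g.
Proof.
move=> m e; rewrite -{1}(gK m) /Ycoef -f_hom tmap_comp.
by rewrite -[RHS]tmap_id; apply: eq_tmap.
Qed.

Lemma Lop_transport k m :
  Lop (voc_rho V) (comod_Delta M2) k (f m) = f (Lop (voc_rho V) (comod_Delta M1) k m).
Proof. by rewrite !LopE /Ycoef -f_hom tcontl_tmap. Qed.

Lemma tmap_transport_inj (U : lmodType K) : injective (@tmap K U U _ _ idfun f).
Proof.
apply: (can_inj (g := tmap idfun g)) => t; rewrite tmap_comp -[RHS]tmap_id.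
by apply: eq_tmap.
Qed.

Lemma jacobi_transport :
  jacobi (voc_Delta V) (comod_Delta M1) -> jacobi (voc_Delta V) (comod_Delta M2).
Proof.
move=> jac m a b d; rewrite -(gK m); move: (g m) => {}m.
have step k1 k2 :
    tassoc _ _ _ (tmap idfun (comod_Delta M2 k2) (comod_Delta M2 k1 (f m))) =
    tmap idfun f (tassoc _ _ _ (tmap idfun (comod_Delta M1 k2) (comod_Delta M1 k1 m))).
  rewrite -tassoc_tmap -f_hom !tmap_comp; congr (tassoc _ _ _ _).
  by apply: eq_tmap => // x /=; rewrite f_hom.
have f_inj := @tmap_transport_inj (tensor (voc_space V) (voc_space V)).
rewrite (zmul12_inj_linear f_inj _ _ _ _ (fun e1 e2 => step (- e1 - 1) (- e2 - 1))).
rewrite (@zmul12_inj_linear _ _ _ _ f_inj _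
  (fun e1 e2 => tmap (tswap _ _) idfun (tassoc _ _ _
    (tmap idfun (comod_Delta M1 (- e1 - 1)) (Ycoef (comod_Delta M1) m e2))))); last first.
  by move=> e1 e2; rewrite step !tmap_comp; apply: eq_tmap.
rewrite -linearB jac; symmetry; apply: zmul02_inj_linear => // e0 e2.
by rewrite /Ycoef -f_hom !tmap_comp; apply: eq_tmap.
Qed.

Hypothesis f_graded : forall t (x : comod_gr M1 t),
  exists y : comod_gr M2 t, f (inj x) = inj y.
Hypothesis g_graded : forall t (y : comod_gr M2 t),
  exists x : comod_gr M1 t, g (inj y) = inj x.

Lemma admissible_transport : admissible M1 -> admissible M2.
Proof.
move=> [trunc counit jac vir der homog]; split.
- move=> m; have [N NP] := trunc (g m); exists N => k kN.
  by rewrite -(gK m) -f_hom NP // linear0.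
- move=> m e; rewrite -(gK m) /Ycoef -f_hom tcontl_tmap [tcontl _ _ _](counit (g m) e).
  by case: ifP => _; rewrite ?gK ?linear0.
- exact: jacobi_transport.
- move=> k j m; rewrite -(gK m) !Lop_transport -linearB vir.
  by rewrite linearD !linearZ.
- move=> m e; have [d1 d2] := der (g m) e; rewrite -(gK m).
  have YE : Ycoef (comod_Delta M2) (f (g m)) =1
      (fun e => tmap idfun f (Ycoef (comod_Delta M1) (g m) e)).
    by move=> e'; rewrite /Ycoef f_hom.
  have zE : zderiv (Ycoef (comod_Delta M2) (f (g m))) e =
      tmap idfun f (zderiv (Ycoef (comod_Delta M1) (g m)) e).
    by rewrite /zderiv YE linearZ.
  split; first by rewrite zE -d1 YE !tmap_comp; apply: eq_tmap.
  rewrite zE d2 Lop_transport linearB; congr (_ - _); first by rewrite /Ycoef f_hom.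
  by rewrite YE !tmap_comp; apply: eq_tmap => // x; symmetry; exact: (Lop_transport 1).
- move=> k t y; have [x xy] := g_graded y.
  rewrite -[inj y]gK xy -f_hom.
  elim: (homog k t x) => [|i j u v T ij _ IH]; first by rewrite linear0; constructor.
  rewrite linearD tmapE; have [w ->] := f_graded v; exact: HomogeneousD.
Qed.

End Transport.

(** * The double contragredient *)

Section Coefficients.
Variable K : fieldType.
Hypothesis K0 : [pchar K] =i pred0.

(** The coefficient of x^P in e^(-x) e^x. *)
Lemma sum_exp_coef_mul P :
  \sum_(n < P.+1) ((-1) ^+ n / n`!%:R) * ((P - n)`!%:R)^-1 = (P == 0)%:R :> K.
Proof.
have fact_neq0 n : n`!%:R != 0 :> K.
  by rewrite ((pcharf0P K).1 K0) -lt0n fact_gt0.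
apply: (mulfI (fact_neq0 P)); rewrite mulr_sumr.
transitivity ((1 - 1 : K) ^+ P); last first.
  by rewrite subrr expr0n; case: P => [|P] /=; rewrite ?mulr0 // fact0 mulr1.
rewrite exprDn; apply: eq_bigr => n _; have nP : (n <= P)%N by rewrite -ltnS.
rewrite expr1n mul1r -mulr_natr -(bin_fact nP) !natrM.
by field; rewrite !fact_neq0.
Qed.

(** The coefficients with n + k = j add up to that of x^j in e^(-x) e^x = 1. *)
Lemma triangular_exp_sum (G : nat -> K) P : (0 < P)%N ->
  \sum_(n < P) \sum_(k < P - n) ((-1) ^+ n / n`!%:R) * (k`!%:R)^-1 * G (n + k)%N = G 0.
Proof.
case: P => // P _; elim: P => [|P IH].
  by rewrite !big_ord1 fact0 divr1 invr1 !mul1r.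
have last_sum := sum_exp_coef_mul P.+1; rewrite big_ord_recr /= in last_sum.
rewrite big_ord_recr /= subSnn big_ord1 addn0 -[RHS]addr0.
have := congr1 ( *%R^~ (G P.+1)) last_sum; rewrite mul0r => last0.
rewrite -[X in _ = _ + X]last0 -[X in _ = X + _]IH mulrDl mulr_suml addrA -big_split.
rewrite subnn /=; congr (_ + _).
apply: eq_bigr => n _; have nP : (n <= P.+1)%N by exact: ltnW.
by rewrite subSn // big_ord_recr /= subnKC.
Qed.

Lemma signz_mul_sub (r : int) n : (-1) ^ r * (-1) ^ (r - n%:Z) = (-1) ^+ n :> K.
Proof.
have N1 : -1 != 0 :> K by rewrite oppr_eq0 oner_eq0.
rewrite expfzDr // mulrA -expfzMl mulrNN mulr1 exp1rz mul1r.
by rewrite -exprnN -exprVn invrN1.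
Qed.

End Coefficients.

Section DoubleContragredient.
Variables (K : fieldType) (V : gvoc K) (M : comod_data V).
Hypothesis K0 : [pchar K] =i pred0.
Hypothesis rho_V2 : rho_weight_two V.
Local Notation L := (voc_L V (-1)).
Local Notation D := (comod_Delta M).
Variable D' : int -> {linear dsum (dual_family (comod_gr M)) ->
  tensor (voc_space V) (dsum (dual_family (comod_gr M)))}.
Hypothesis D'_contragredient : contragredient_eq D'.
Local Notation M' := (ComodData D').

(** The identity T(1/z) T(z) = Id, paired with a form g of weight r. The inner pairing is
taken at g L(-1)^n, of weight r - n, hence the signs (-1)^r and (-1)^(r-n), whose product
is (-1)^n. *)
Lemma twisted_pairing_involutive e r (g : dual_family (voc_gr V) r) m m' :
  twisted_pairing (M := M') e (inj g) m' (to_bidual m) =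
  tform (gform (inj g)) (gform m') (Ycoef D m e).
Proof.
have [N V_bounded] := voc_bounded_below V.
pose P := `|r - N|%N.+1; have rP : (r - P%:Z < N)%R by rewrite /P; lia.
rewrite (twisted_pairing_inj rho_V2 V_bounded _ _ _ _ rP).
pose G j : K := tform (gform (inj g) \o lin_iter L j) (gform m') (Ycoef D m (j%:Z + e)).
have -> : tform (gform (inj g)) (gform m') (Ycoef D m e) = G 0.
  by rewrite /G add0r; apply: eq_tform.
rewrite -(triangular_exp_sum K0 G (ltn0Sn _ : (0 < P)%N)); apply: eq_bigr => n _.
have [gn gnE] := voc_L_iter_dual rho_V2 n g.
transitivity (((-1) ^ r / n`!%:R : K) *:
    tform (gform (inj gn)) (geval m) (Ycoef D' m' (n%:Z - 2 * r - e))).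
  congr (_ *: _); apply: eq_tform => [v|f]; first by symmetry; exact: gnE.
  exact: gform_to_bidual.
rewrite D'_contragredient.
have nP : (r - n%:Z - (P - n)%N%:Z < N)%R by have := ltn_ord n; lia.
rewrite -[bigop.body _ _ _]/(twisted_pairing (n%:Z - 2 * r - e) (inj gn) m m').
rewrite (twisted_pairing_inj rho_V2 V_bounded _ _ _ _ nP) scaler_sumr.
apply: eq_bigr => k _; rewrite scalerA mulrACA signz_mul_sub mulrA.
have -> : tform (gform (inj gn) \o lin_iter L k) (gform m')
    (Ycoef D m (k%:Z - 2 * (r - n%:Z) - (n%:Z - 2 * r - e))) = G (n + k)%N.
  rewrite /G.
  have -> : (n + k)%:Z + e = k%:Z - 2 * (r - n%:Z) - (n%:Z - 2 * r - e) by lia.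
  by apply: eq_tform => // v; rewrite [LHS]gnE /= iterD.
by [].
Qed.

(** The coaction of M transported along M -> M'', with g the inverse of that map. *)
Lemma double_contragredient_eq
    (g : {linear dsum (dual_family (dual_family (comod_gr M))) -> comod_space M}) :
  cancel g (@to_bidual _ _ (comod_gr M)) ->
  contragredient_eq (M := M')
    (fun k => tmap idfun (@to_bidual _ _ (comod_gr M)) \o D k \o g).
Proof.
move=> gK f m' m'' e; have [N V_bounded] := voc_bounded_below V.
rewrite -[RHS]/(twisted_pairing (M := M') e f m' m'').
rewrite -[in RHS](gK m''); set m := g m''.
rewrite -[Ycoef _ m'' e]/(tmap idfun to_bidual (Ycoef D m e)).
have -> : tform (gform f) (geval m') (tmap idfun to_bidual (Ycoef D m e)) =
    tform (gform f) (gform m') (Ycoef D m e).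
  by rewrite [LHS]tform_tmap; apply: eq_tform.
have lin : linear (fun f => tform (gform f) (gform m') (Ycoef D m e)).
  by move=> a f1 f2; apply: tform_linearl => v; exact: gpair_linearl.
move: f; apply: (@linear_dsum_ext _ _ _ _ (mk_linear lin)
  (mk_linear (@twisted_pairing_linear_f _ _ M' rho_V2 N V_bounded e m'
    (to_bidual m)))) => r h.
by symmetry; exact: twisted_pairing_involutive.
Qed.

End DoubleContragredient.

Lemma double_contragredient_iso (K : fieldType) (V : gvoc K) (M : comod_data V) :
  [pchar K] =i pred0 -> rho_weight_two V -> admissible M ->
  (forall t, finite_dim (comod_gr M t)) ->
  admissible (contragredient (contragredient M)) /\
  comod_isomorphic (contragredient (contragredient M)) M.
Proof.
move=> K0 rho_V2 admM M_fin; have [N V_bounded] := voc_bounded_below V.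
have [D' eqD'] := contragredient_eq_exists rho_V2 V_bounded (comod_homogeneous admM)
  (@voc_finite_dim K V) M_fin.
rewrite (contragredientE eqD').
have [g fK gK] := to_bidual_bij M_fin.
pose gl := mk_linear (can2_linear fK gK).
rewrite (contragredientE (double_contragredient_eq K0 rho_V2 eqD' (g := gl) gK)).
set M'' := ComodData _.
pose f : {linear comod_space M -> comod_space M''} := @to_bidual _ _ (comod_gr M).
have f_hom k m : tmap idfun f (comod_Delta M k m) = comod_Delta M'' k (f m).
  by rewrite /= fK.
split.
  apply: (@admissible_transport _ _ _ _ f gl fK gK f_hom _ _ admM) => t x.
    by exists (eval_form x); exact: to_bidual_inj.
  have [y ->] := eval_form_surj M_fin x; exists y.
  by rewrite -to_bidual_inj; exact: fK.
exists gl; split; first by exists f.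
exact: comod_hom_inv f_hom.
Qed.

Local Open Scope complex_scope.

Theorem proposition3p7 (R : realType) (V : gvoc R[i]) (M : comod_data V)
    (rho_V2 : rho_weight_two V)
    (M_admissible : admissible M)
    (M_finite_dim : forall t : nat, finite_dim (comod_gr M t)) :
  admissible (contragredient (contragredient M)) /\
  comod_isomorphic (contragredient (contragredient M)) M.
Proof.
by apply: double_contragredient_iso => //; exact: Num.Theory.pchar_num.
Qed.
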